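(* Let $n\ge 1$. (i) Every domain of tiling type in $\mathcal L([n])$ is semi-connected. (ii) Every semi-connected Condorcet domain in $\mathcal L([n])$ is a peak-pit domain. (iii) Every peak-pit domain in $\mathcal L([n])$ is contained in a domain of tiling type.
   Context: Linear orders. $[n]=\{1,\dots,n\}$, and $\mathcal L([n])$ is the set of linear orders on $[n]$. A linear order $x_1<\dots<x_n$ is encoded by the word $x_1\dots x_n$ ($x_1$ is the least, or worst, element). $\alpha$ denotes the order $1<2<\dots<n$ and $\omega$ the order $n<n-1<\dots<1$. For a linear order $\sigma$, $Inv(\sigma)=\{(i,j): 1\le i<j\le n,\ j<_\sigma i\}$. A linear order $\tau$ covers $\sigma$ if $Inv(\tau)$ equals $Inv(\sigma)$ plus exactly one inversion. The Bruhat graph is the undirected graph on $\mathcal L([n])$ in which $\sigma,\tau$ are adjacent iff one of them covers the other. Domains. All domains $\mathcal D\subseteq\mathcal L([n])$ considered contain both $\alpha$ and $\omega$. A domain is cyclic if there exist three elements $i,j,k$ and three linear orders in $\mathcal D$ whose restrictions to $\{i,j,k\}$ are of the form $\{ijk,jki,kij\}$ or $\{kji,jik,ikj\}$; a Condorcet domain is a domain that is not cyclic. $\mathcal D$ is a peak-pit domain if for each triple $i<j<k$ in $[n]$ the set of restrictions of members of $\mathcal D$ to $\{i,j,k\}$ is contained in $\{ijk,ikj,kij,kji\}$ (the peak domain: $j$ is never the least) or in $\{ijk,jik,jki,kji\}$ (the pit domain: $j$ is never the greatest), or in both. $\mathcal D$ is semi-connected if $\alpha$ and $\omega$ can be connected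 in the Bruhat graph by a path all of whose vertices belong to $\mathcal D$. Domains of tiling type. In the upper half-plane $\mathbb R\times\mathbb R_{>0}$ fix $n$ vectors $\xi_1,\dots,\xi_n$ of the same length and with distinct directions, going in this order clockwise around $(0,0)$. The zonogon is $Z_n=\{\sum_i a_i\xi_i: 0\le a_i\le 1\}$; its bottom vertex is $(0,0)$ and its top vertex is $\xi_1+\dots+\xi_n$. For $i<j$, an $ij$-tile is a translate of the rhombus $[0,\xi_i]+[0,\xi_j]$. A rhombus tiling $T$ of $Z_n$ is a subdivision of $Z_n$ into such tiles in which any two intersecting tiles meet in a single vertex or a single closed edge. $G_T$ is the planar directed graph formed by the vertices and edges of the tiles, with edges directed upward; an edge that is a translate of $[0,\xi_i]$ has color $i$. (For $n=1$, $Z_1$ is the segment $[0,\xi_1]$ and $G_T$ is a single edge.) A snake of $T$ is a directed path in $G_T$ from the bottom vertex to the top vertex. It is known that each snake has exactly $n$ edges, one of each color, so the sequence of colors along it (from bottom to top) is a linear order on $[n]$, the first color being the least element. $\Sigma(T)$ is the set of all linear orders obtained in this way. A domain of tiling type is a domain of the form $\Sigma(T)$ for a rhombus tiling $T$ of $Z_n$. *)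

(* Defs.v *)
From mathcomp Require Import all_boot all_order all_algebra all_fingroup.
From mathcomp Require Import classical_sets reals.

Set Implicit Arguments.
Unset Strict Implicit.
Unset Printing Implicit Defensive.

Import Order.TTheory GRing.Theory Num.Theory.

Local Open Scope ring_scope.

(* The ground set [n] is 'I_n = {0, ..., n-1}. A linear order
   x_0 < x_1 < ... < x_(n-1) on it is the permutation s : 'S_n with s k = x_k,
   so s sends a rank to an element, s^-1 sends an element to its rank, and
   rank 0 is the least (worst) element. *)

Definition word (n : nat) (s : 'S_n) : seq 'I_n := [seq s k | k <- enum 'I_n].

Definition lt_in (n : nat) (s : 'S_n) (x y : 'I_n) : bool :=
  ((s^-1)%g x < (s^-1)%g y)%N.

Definition alpha (n : nat) : 'S_n := 1%g.

Definition omega (n : nat) : 'S_n := perm (@rev_ord_inj n).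

Definition Inv (n : nat) (s : 'S_n) : {set 'I_n * 'I_n} :=
  [set e : 'I_n * 'I_n | (e.1 < e.2)%N && lt_in s e.2 e.1].

Definition covers (n : nat) (t s : 'S_n) : bool :=
  [exists e, (e \notin Inv s) && (Inv t == e |: Inv s)].

Definition bruhat (n : nat) : rel 'S_n := fun s t => covers t s || covers s t.

Definition restriction (n : nat) (s : 'S_n) (i j k : 'I_n) : seq 'I_n :=
  [seq x <- word s | x \in [:: i; j; k]].

Definition has_ends (n : nat) (D : {set 'S_n}) : Prop :=
  alpha n \in D /\ omega n \in D.

Definition cyclic_domain (n : nat) (D : {set 'S_n}) : Prop :=
  exists i j k : 'I_n, uniq [:: i; j; k] /\
  exists s1 s2 s3 : 'S_n, [/\ s1 \in D, s2 \in D, s3 \in D &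
    [/\ restriction s1 i j k = [:: i; j; k],
        restriction s2 i j k = [:: j; k; i]
      & restriction s3 i j k = [:: k; i; j]]
    \/
    [/\ restriction s1 i j k = [:: k; j; i],
        restriction s2 i j k = [:: j; i; k]
      & restriction s3 i j k = [:: i; k; j]]].

Definition condorcet_domain (n : nat) (D : {set 'S_n}) : Prop :=
  has_ends D /\ ~ cyclic_domain D.

Definition peak_on (n : nat) (D : {set 'S_n}) (i j k : 'I_n) : Prop :=
  forall s, s \in D -> restriction s i j k \in
    [:: [:: i; j; k]; [:: i; k; j]; [:: k; i; j]; [:: k; j; i]].

Definition pit_on (n : nat) (D : {set 'S_n}) (i j k : 'I_n) : Prop :=
  forall s, s \in D -> restriction s i j k \in
    [:: [:: i; j; k]; [:: j; i; k]; [:: j; k; i]; [:: k; j; i]].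

Definition peak_pit_domain (n : nat) (D : {set 'S_n}) : Prop :=
  has_ends D /\
  forall i j k : 'I_n, (i < j)%N -> (j < k)%N -> peak_on D i j k \/ pit_on D i j k.

Definition semi_connected (n : nat) (D : {set 'S_n}) : Prop :=
  has_ends D /\
  exists p : seq 'S_n, [/\ path (@bruhat n) (alpha n) p,
                           last (alpha n) p = omega n
                         & all (mem D) (alpha n :: p)].

Definition xcoord (R : realType) (v : 'rV[R]_2) : R := v 0 0.
Definition ycoord (R : realType) (v : 'rV[R]_2) : R := v 0 1.
Definition vlength (R : realType) (v : 'rV[R]_2) : R :=
  Num.sqrt (xcoord v ^+ 2 + ycoord v ^+ 2).

(* For vectors of the open upper half-plane, a negative cross product says
   exactly that the directions are distinct and that v comes after u when
   turning clockwise around the origin. *)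
Definition clockwise (R : realType) (u v : 'rV[R]_2) : Prop :=
  xcoord u * ycoord v - ycoord u * xcoord v < 0.

Definition generators (R : realType) (n : nat) (xi : 'I_n -> 'rV[R]_2) : Prop :=
  [/\ forall i, 0 < ycoord (xi i),
      forall i j, vlength (xi i) = vlength (xi j)
    & forall i j : 'I_n, (i < j)%N -> clockwise (xi i) (xi j)].

Definition zonogon (R : realType) (n : nat) (xi : 'I_n -> 'rV[R]_2) :
    set 'rV[R]_2 :=
  [set v | exists2 a : 'I_n -> R,
     forall i, 0 <= a i <= 1 & v = \sum_i a i *: xi i]%classic.

(* The edge e = (p, i) is the segment p + [0, xi i]: it has color i and is
   directed from p up to p + xi i. *)
Definition edge_set (R : realType) (n : nat) (xi : 'I_n -> 'rV[R]_2)
    (e : 'rV[R]_2 * 'I_n) : set 'rV[R]_2 :=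
  [set v | exists2 a : R, 0 <= a <= 1 & v = e.1 + a *: xi e.2]%classic.

(* The triple (p, i, j), meant for i < j, is the ij-tile with bottom vertex p. *)
Notation tile R n := ('rV[R]_2 * 'I_n * 'I_n)%type.

Definition tile_set (R : realType) (n : nat) (xi : 'I_n -> 'rV[R]_2)
    (t : tile R n) : set 'rV[R]_2 :=
  let: (p, i, j) := t in
  [set v | exists a b : R, [/\ 0 <= a <= 1, 0 <= b <= 1
                             & v = p + a *: xi i + b *: xi j]]%classic.

Definition tile_vertices (R : realType) (n : nat) (xi : 'I_n -> 'rV[R]_2)
    (t : tile R n) : seq 'rV[R]_2 :=
  let: (p, i, j) := t in [:: p; p + xi i; p + xi j; p + xi i + xi j].

Definition tile_edges (R : realType) (n : nat) (xi : 'I_n -> 'rV[R]_2)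
    (t : tile R n) : seq ('rV[R]_2 * 'I_n) :=
  let: (p, i, j) := t in [:: (p, i); (p, j); (p + xi j, i); (p + xi i, j)].

(* When n = 1 the zonogon is a segment, there are no tiles (so the covering
   condition is dropped), and the only tiling is the empty one. *)
Definition rhombus_tiling (R : realType) (n : nat) (xi : 'I_n -> 'rV[R]_2)
    (T : seq (tile R n)) : Prop :=
  [/\ forall t : tile R n, t \in T -> (t.1.2 < t.2)%N,
      n != 1%N ->
        (\bigcup_(t in [set t | t \in T]) tile_set xi t)%classic = zonogon xi
    & forall t t' : tile R n, t \in T -> t' \in T -> t != t' ->
        (tile_set xi t `&` tile_set xi t' !=set0)%classic ->
        (exists v : 'rV[R]_2, [/\ v \in tile_vertices xi t, v \in tile_vertices xi t'
           & (tile_set xi t `&` tile_set xi t' = [set v])%classic]) \/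
        (exists e : 'rV[R]_2 * 'I_n, [/\ e \in tile_edges xi t, e \in tile_edges xi t'
           & (tile_set xi t `&` tile_set xi t')%classic = edge_set xi e])].

(* The colored directed edges of G_T; for n = 1 there is just the edge
   from 0 to xi_1. *)
Definition graph_edges (R : realType) (n : nat) (xi : 'I_n -> 'rV[R]_2)
    (T : seq (tile R n)) : seq ('rV[R]_2 * 'I_n) :=
  if n == 1%N then [seq (0, i) | i <- enum 'I_n]
  else flatten [seq tile_edges xi t | t <- T].

(* w is the color sequence of a directed path of G_T from p to q. The vertices
   of the path are determined by p and w. *)
Fixpoint directed_path (R : realType) (n : nat) (xi : 'I_n -> 'rV[R]_2)
    (T : seq (tile R n)) (p : 'rV[R]_2) (w : seq 'I_n)
    (q : 'rV[R]_2) : bool :=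
  if w is i :: w' then
    ((p, i) \in graph_edges xi T) && directed_path xi T (p + xi i) w' q
  else p == q.

Definition snake (R : realType) (n : nat) (xi : 'I_n -> 'rV[R]_2)
    (T : seq (tile R n)) (w : seq 'I_n) : bool :=
  directed_path xi T 0 w (\sum_i xi i).

Definition Sigma (R : realType) (n : nat) (xi : 'I_n -> 'rV[R]_2)
    (T : seq (tile R n)) : {set 'S_n} :=
  [set s | snake xi T (word s)].

Definition tiling_type (R : realType) (n : nat) (xi : 'I_n -> 'rV[R]_2)
    (D : {set 'S_n}) : Prop :=
  exists T : seq (tile R n), rhombus_tiling xi T /\ D = Sigma xi T.

(* Main.v *)
Require Import Defs.
From mathcomp Require Import all_boot all_order all_algebra all_fingroup.
From mathcomp Require Import boolp classical_sets reals.
From mathcomp Require Import zify ring lra.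

Set Implicit Arguments.
Unset Strict Implicit.
Unset Printing Implicit Defensive.

Import Order.TTheory GRing.Theory Num.Theory.

(** A color word is read as a path from the bottom of the zonogon to its top;
words and linear orders are identified, and replacing two neighbours i j with
i < j by j i moves the path to the right across the rhombus that the edges of
color i and j span.

(i) Call a vertex of a tiling extreme if no point just east of it is in the
zonogon. An edge of the tiling either has two extreme ends, or is the lower
left edge of a tile (whose left vertex, the top of the edge, is not extreme),
or is the upper left edge of a tile (whose left vertex, the bottom of the edge,
is not extreme); this is [edge_trichotomy]. Bottom and top of the zonogon are
extreme. Along a snake with a non-extreme vertex some lower left edge is
therefore followed by an upper left edge; the two tiles have the same left
vertex, hence coincide, and the snake can be pushed across this tile
([snake_flip]). A snake other than omega has an ascent, hence a non-extreme
vertex, so the pushing only stops at omega. It can start from alpha because the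
left side of the zonogon consists of edges of tiles ([alpha_edge]).

(ii) On a path from alpha to omega the pair i < k is reversed in one step,
during which j stays below both or above both. This gives two of the
restrictions with j lowest, or two with j highest; together with the
restrictions of alpha and omega they forbid, by acyclicity, every restriction
with j highest, or every one with j lowest.

(iii) Let F be the family of all initial segments of the orders of a peak-pit
domain. Two of them never alternate: there are no i < j < k with i and k in
one of them only and j in the other one only ([peak_pit_separated]). Say that a
word is compatible with a set Y if all its pairs made of an x outside Y
followed by a y in Y are ascending (the path is on the left of Y), or all
descending (on its right). The word alpha is compatible with all sets. The
combinatorial core is that a word other than omega that is compatible with all
of F has an ascent whose reversal preserves this ([free_ascent], by way of
[free_cut]). So there is a chain of compatible words from alpha to omega, one
reversal at a time. An edge from Y to Y + x of a member of the domain lies on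
one of these words: at the moment when Y or Y + x passes from the right of the
path to its left, both are initial segments of the word
([sweep_through_edge]).

It remains to see that the rhombi crossed by the chain form a tiling. A path is
the graph of a function of the height ([path_x]), and a reversal increases this
function strictly inside the range of heights of its rhombus and nowhere else;
so the rhombi cover the zonogon ([sweep_covers]). A point common to two rhombi
lies on every path in between; none of the intermediate reversals happens at
its height, so that the vertex or edge containing it is the same on all of
these paths, and is a face of both rhombi. Two different rhombi cannot share
two vertices that are not neighbours, so that all common points are in one
common face ([sweep_tiles_meet]). *)

(** * Words and inversions *)

Section Words.
Variable n : nat.
Implicit Types (s t : 'S_n) (w u v : seq 'I_n) (x y i j k : 'I_n).

Definition before w x y := (index x w < index y w)%N.

Lemma size_word s : size (word s) = n.
Proof. by rewrite size_map size_enum_ord. Qed.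

Lemma word_uniq s : uniq (word s).
Proof. by rewrite map_inj_uniq ?enum_uniq //; exact: perm_inj. Qed.

Lemma perm_word s : perm_eq (word s) (enum 'I_n).
Proof.
apply: uniq_perm; rewrite ?word_uniq ?enum_uniq // => x.
rewrite mem_enum; apply/mapP; exists ((s^-1)%g x); rewrite ?mem_enum //.
by rewrite permKV.
Qed.

Lemma index_word s x : index x (word s) = (s^-1)%g x :> nat.
Proof.
by rewrite -{1}[x](permKV s) index_map ?index_enum_ord //; exact: perm_inj.
Qed.

Lemma lt_inE s x y : lt_in s x y = before (word s) x y.
Proof. by rewrite /before !index_word. Qed.

Lemma word_inj : injective (@word n).
Proof.
move=> s t /eqP; rewrite /word => /eqP/eq_in_map st; apply/permP => x.
by apply: st; rewrite mem_enum.
Qed.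

Lemma word_surj w : perm_eq w (enum 'I_n) -> exists s, word s = w.
Proof.
move=> pw; have sw : size w = n by rewrite (perm_size pw) size_enum_ord.
have uw : uniq w by rewrite (perm_uniq pw) enum_uniq.
pose f (k : 'I_n) := nth k w k.
have f_inj : injective f.
  move=> k l; rewrite /f (set_nth_default k l) ?sw // => /eqP.
  by rewrite nth_uniq ?sw // => /eqP/val_inj.
exists (perm f_inj); case Ew: {1}w => [|x0 w'].
  by apply: size0nil; rewrite size_word -sw Ew.
apply: (@eq_from_nth _ x0) => [|k]; rewrite size_word -?Ew ?sw // => lt_k.
have szk : (k < size (enum 'I_n))%N by rewrite size_enum_ord.
rewrite (nth_map x0) // permE /f nth_enum_ord //.
by apply: set_nth_default; rewrite sw.
Qed.

Lemma before_asym w x y : before w x y -> ~~ before w y x.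
Proof. by rewrite /before; lia. Qed.

Lemma before_trans w : transitive (before w).
Proof. by move=> x y z; rewrite /before; lia. Qed.

Lemma before_total w x y : perm_eq w (enum 'I_n) -> x != y ->
  ~~ before w x y = before w y x.
Proof.
move=> pw xy; rewrite /before.
suff : index x w != index y w by lia.
apply: contra xy => /eqP ixy; apply/eqP.
have inw z : z \in w by rewrite (perm_mem pw) mem_enum.
by rewrite -(nth_index x (inw x)) ixy nth_index.
Qed.

Lemma before_enum x y : before (enum 'I_n) x y = (x < y)%N.
Proof. by rewrite /before !index_enum_ord. Qed.

Lemma word_alpha : word (alpha n) = enum 'I_n.
Proof. by rewrite /word (eq_map (perm1 (T := 'I_n))) map_id. Qed.

Lemma index_word_omega x : index x (word (omega n)) = (n - x.+1)%N.
Proof.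
rewrite index_word; set y := ((omega n)^-1)%g x.
have <- : omega n y = x by rewrite permKV.
by rewrite permE /=; have := ltn_ord y; lia.
Qed.

Lemma before_omega x y : before (word (omega n)) x y = (y < x)%N.
Proof.
rewrite /before !index_word_omega.
by have := ltn_ord x; have := ltn_ord y; lia.
Qed.

Lemma before_cat u v x y : uniq (u ++ v) -> x \in u -> y \in v ->
  before (u ++ v) x y.
Proof.
rewrite cat_uniq => /and3P[_ /hasPn uv _] xu yv.
rewrite /before !index_cat xu (negbTE (uv y yv)).
by rewrite -index_mem in xu; lia.
Qed.

Lemma index_pair u v i j x : index x (u ++ i :: j :: v) =
  if x \in u then index x u else if x == i then size u else
  if x == j then (size u).+1 else ((size u).+2 + index x v)%N.
Proof.
by rewrite index_cat /= ![_ == x]eq_sym; do !case: ifP => // _; lia.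
Qed.

Lemma before_pair u v i j x : uniq (u ++ i :: j :: v) ->
  (x != i -> before (u ++ i :: j :: v) x j -> before (u ++ i :: j :: v) x i) /\
  (x != j -> before (u ++ i :: j :: v) i x -> before (u ++ i :: j :: v) j x).
Proof.
rewrite cat_uniq /= !inE !negb_or.
case/and3P=> _ /and3P[iu ju _] /and3P[/andP[ij _] _ _].
have lt_u : x \in u -> (index x u < size u)%N by rewrite -index_mem.
rewrite /before !index_pair (negbTE iu) (negbTE ju) !eqxx [j == i]eq_sym (negbTE ij).
by split=> [/negbTE->|/negbTE->]; case: ifP => [/lt_u|_]; do ?[case: ifP => _]; lia.
Qed.

Lemma before_swap u v i j x y : uniq (u ++ i :: j :: v) ->
  before (u ++ j :: i :: v) x y =
  ((x == j) && (y == i)) ||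
  (before (u ++ i :: j :: v) x y && ~~ ((x == i) && (y == j))).
Proof.
rewrite cat_uniq /= !inE !negb_or.
case/and3P=> _ /and3P[iu ju _] /and3P[/andP[ij _] _ _].
have lt_u z : z \in u -> (index z u < size u)%N by rewrite -index_mem.
rewrite /before !index_pair.
have [->|xi] := eqVneq x i; have [->|yi] := eqVneq y i.
- by rewrite (negbTE iu) ltnn (negbTE ij) andbF andbT ltnn.
- rewrite (negbTE iu) (negbTE ij) /=.
  have [->|yj] := eqVneq y j; first by rewrite (negbTE ju); lia.
  by case: ifP => [/lt_u|_]; lia.
- rewrite (negbTE iu) (negbTE ij) /=.
  have [->|xj] := eqVneq x j; first by rewrite (negbTE ju); lia.
  by case: ifP => [/lt_u|_]; lia.
rewrite /=.
have [->|xj] := eqVneq x j; have [->|yj] := eqVneq y j => //=;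
  rewrite ?(negbTE ju) //; do ?[case: ifP => [/lt_u|_]]; lia.
Qed.

Definition inversions w : {set 'I_n * 'I_n} :=
  [set e : 'I_n * 'I_n | (e.1 < e.2)%N && before w e.2 e.1].

Lemma InvE s : Inv s = inversions (word s).
Proof. by apply/setP => e; rewrite !inE lt_inE. Qed.

Lemma inversions_swap u v i j : uniq (u ++ i :: j :: v) -> (i < j)%N ->
  (i, j) \notin inversions (u ++ i :: j :: v) /\
  inversions (u ++ j :: i :: v) = (i, j) |: inversions (u ++ i :: j :: v).
Proof.
move=> uw ij; split.
  rewrite inE ij /= before_asym //.
  have -> : u ++ i :: j :: v = (u ++ [:: i]) ++ j :: v by rewrite -catA.
  apply: before_cat; rewrite -?catA //= ?mem_cat !inE ?eqxx ?orbT //.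
apply/setP => -[x y]; rewrite !inE before_swap //= xpair_eqE [(x == i) && _]andbC.
have [/andP[/eqP-> /eqP->]|_] /= := boolP ((y == j) && (x == i)).
  by rewrite ij.
have [/andP[/eqP-> /eqP->]|_] := boolP ((y == i) && (x == j)); last by rewrite andbT.
by rewrite andbF ltnNge (ltnW ij) .
Qed.

Lemma covers_swap s t u v i j : (i < j)%N -> word s = u ++ i :: j :: v ->
  word t = u ++ j :: i :: v -> covers t s.
Proof.
move=> ij ws wt; have := word_uniq s; rewrite ws => uw.
have [nij eqI] := inversions_swap uw ij.
by apply/existsP; exists (i, j); rewrite !InvE ws wt nij eqI eqxx.
Qed.

Lemma sorted_before w : uniq w -> sorted (before w) w.
Proof.
case: w => [//|x0 w] uw; apply/(sortedP x0) => k lt_k.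
by rewrite /before !index_uniq // ltnW.
Qed.

Lemma ascent_or_omega w : perm_eq w (enum 'I_n) -> w != word (omega n) ->
  exists u i j v, w = u ++ i :: j :: v /\ (i < j)%N.
Proof.
move=> pw neq.
have uw : uniq w by rewrite (perm_uniq pw) enum_uniq.
have : ~~ sorted (fun x y : 'I_n => (y < x)%N) w.
  apply: contra neq => srt; apply/eqP.
  apply: (irr_sorted_eq (leT := fun x y : 'I_n => (y < x)%N)) => //.
  - by move=> x y z /=; lia.
  - by move=> x /=; lia.
  - rewrite (eq_sorted (e' := before (word (omega n)))).
      exact/sorted_before/word_uniq.
    by move=> x y; rewrite before_omega.
  by move=> x; rewrite (perm_mem pw) (perm_mem (perm_word _)).
elim: w uw {pw neq} => //= x [|y w] //= IH /andP[xw uw].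
rewrite negb_and => /orP[xy|/(IH uw)[u [i [j [v [-> ij]]]]]].
  exists [::], x, y, w; split=> //; rewrite !inE negb_or in xw.
  by case/andP: xw => /eqP xw _; apply/negPn; apply: contra xy => xy;
     rewrite ltn_neqAle; apply/andP; split; [apply/eqP => /val_inj /esym | lia].
by exists (x :: u), i, j, v.
Qed.

End Words.

(** * Semi-connected Condorcet domains *)

Section SemiConnectedCondorcet.
Variable n : nat.
Implicit Types (s t : 'S_n) (i j k a b c : 'I_n) (D : {set 'S_n}).

(** The restriction is sorted by s, and only one arrangement of i, j, k is. *)
Lemma restrictionE s i j k a b c : uniq [:: a; b; c] ->
    perm_eq [:: a; b; c] [:: i; j; k] ->
  (restriction s i j k == [:: a; b; c]) = lt_in s a b && lt_in s b c.
Proof.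
move=> uabc pabc; rewrite !lt_inE.
have srt : sorted (before (word s)) (restriction s i j k).
  apply: sorted_filter; first exact: before_trans.
  exact/sorted_before/word_uniq.
apply/eqP/idP => [E|abc]; first by move: srt; rewrite E /= andbT.
apply: (irr_sorted_eq (leT := before (word s))) => //.
- exact: before_trans.
- by move=> x; rewrite /before ltnn.
- by rewrite /= andbT.
move=> x; rewrite mem_filter (perm_mem (perm_word s)) mem_enum andbT.
by rewrite (perm_mem pabc).
Qed.

Lemma lt_in_neg s x y : x != y -> ~~ lt_in s x y = lt_in s y x.
Proof. by move=> xy; rewrite !lt_inE before_total ?perm_word. Qed.

Lemma lt_in_trans s x y z : lt_in s x y -> lt_in s y z -> lt_in s x z.
Proof. by rewrite !lt_inE; exact: before_trans. Qed.

Lemma perm3 i j k :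
  (perm_eq [:: j; i; k] [:: i; j; k] * perm_eq [:: j; k; i] [:: i; j; k] *
   perm_eq [:: i; k; j] [:: i; j; k] * perm_eq [:: k; i; j] [:: i; j; k] *
   perm_eq [:: k; j; i] [:: i; j; k])%type.
Proof.
by do !split; apply/seq.permP => p /=; lia.
Qed.

Lemma restriction_cases s i j k : uniq [:: i; j; k] ->
  restriction s i j k \in [:: [:: i; j; k]; [:: j; i; k]; [:: j; k; i];
    [:: i; k; j]; [:: k; i; j]; [:: k; j; i]].
Proof.
move=> uijk; have U (l : seq 'I_n) : perm_eq l [:: i; j; k] -> uniq l.
  by move=> /perm_uniq->.
have [nij njk nik] : [/\ i != j, j != k & i != k].
  by move: uijk; rewrite /= !inE negb_or => /and3P[/andP[-> ->] -> _].
rewrite !inE !restrictionE ?U ?perm3 //.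
rewrite -[lt_in s j i]lt_in_neg // -[lt_in s k j]lt_in_neg // -[lt_in s k i]lt_in_neg //.
have T1 := @lt_in_trans s i j k; have T2 := @lt_in_trans s k j i.
move: T1 T2; rewrite -[lt_in s j i]lt_in_neg // -[lt_in s k j]lt_in_neg //.
rewrite -[lt_in s k i]lt_in_neg //.
by case: (lt_in s i j); case: (lt_in s j k); case: (lt_in s i k) => //= T1 T2.
Qed.

Lemma path_crossing (T : eqType) (e : rel T) (P : pred T) (x : T) p :
    path e x p -> P x -> ~~ P (last x p) ->
  exists y z, [/\ y \in x :: p, z \in x :: p, e y z, P y & ~~ P z].
Proof.
elim: p x => [|z p IH] x /=; first by move=> _ ->.
case/andP=> xz zp Px Pl; have [Pz|Pz] := boolP (P z).
  have [y [t [yp tp yt Py Pt]]] := IH z zp Pz Pl.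
  by exists y, t; split=> //; rewrite in_cons ?yp ?tp orbT.
by exists x, z; rewrite !inE !eqxx orbT.
Qed.

(** Neighbours in the Bruhat graph differ by exactly one inversion, here (i, k). *)
Lemma bruhat_single_change s t (x y i k : 'I_n) : bruhat s t -> (x < y)%N -> (i < k)%N ->
  lt_in s i k -> lt_in t k i -> (x, y) != (i, k) -> lt_in t y x = lt_in s y x.
Proof.
move=> st xy ik sik tki neq.
have inI r a b : (a < b)%N -> lt_in r b a = ((a, b) \in Inv r).
  by move=> ab; rewrite inE /= ab.
have nik : (i, k) \notin Inv s.
  by rewrite -inI // lt_in_neg // neq_ltn ik orbT.
rewrite !inI // in tki *; case/orP: st => /existsP[e /andP[eI /eqP E]]; last first.
  by rewrite E in_setU1 tki orbT in nik.
by move: tki; rewrite E !in_setU1 (negbTE nik) orbF => /eqP <-; rewrite (negbTE neq).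
Qed.

(** At a step of the path that reverses i and k, no other pair changes. So j is
not between i and k: otherwise its comparison with one of them would change too. *)
Lemma semi_connected_side D i j k : semi_connected D -> (i < j)%N -> (j < k)%N ->
  (exists s t, [/\ s \in D, t \in D, restriction s i j k = [:: j; i; k]
                 & restriction t i j k = [:: j; k; i]]) \/
  (exists s t, [/\ s \in D, t \in D, restriction s i j k = [:: i; k; j]
                 & restriction t i j k = [:: k; i; j]]).
Proof.
case=> _ [p [pp pl /allP pD]] ij jk; have ik := ltn_trans ij jk.
have [nij njk nik] : [/\ i != j, j != k & i != k].
  by rewrite !neq_ltn ij jk ik.
have P0 : lt_in (alpha n) i k by rewrite lt_inE word_alpha before_enum.
have PN : ~~ lt_in (last (alpha n) p) i k.
  by rewrite pl lt_inE before_omega -leqNgt ltnW.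
have [s [t [/pD sD /pD tD st sik]]] :=
  path_crossing (P := fun r => lt_in r i k) pp P0 PN.
rewrite lt_in_neg // => tki.
have eij := bruhat_single_change st ij ik sik tki.
have ejk := bruhat_single_change st jk ik sik tki.
have {}eij : lt_in t j i = lt_in s j i.
  by apply: eij; rewrite xpair_eqE eqxx /=.
have {}ejk : lt_in t k j = lt_in s k j.
  by apply: ejk; rewrite xpair_eqE eqxx andbT eq_sym.
have [[u1 u2] u3 u4] : [/\ uniq [:: j; i; k] /\ uniq [:: j; k; i],
    uniq [:: i; k; j] & uniq [:: k; i; j]].
  by rewrite /= !inE !negb_or ![j == i]eq_sym ![k == i]eq_sym ![k == j]eq_sym nij nik njk.
have nkj : k != j by rewrite eq_sym.
have nji : j != i by rewrite eq_sym.
have sd := boolP (lt_in s j i); case: sd => b; [left|right];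
  exists s, t; split=> //; apply/eqP.
- by rewrite restrictionE ?perm3 // b.
- have sjk := lt_in_trans b sik.
  by rewrite restrictionE ?perm3 // tki -lt_in_neg // ejk lt_in_neg // sjk.
- move: b; rewrite -eij lt_in_neg // => tij.
  by rewrite restrictionE ?perm3 // sik -ejk (lt_in_trans tki tij).
- move: b; rewrite -eij lt_in_neg // => tij.
  by rewrite restrictionE ?perm3 // tki tij.
Qed.

(** If jik and jki occur, then ikj would complete a cycle with jik and kji, and kij one
with jki and ijk; so j is never the greatest. The other case is symmetric. *)
Lemma condorcet_semi_connected_peak_pit D :
  condorcet_domain D -> semi_connected D -> peak_pit_domain D.
Proof.
move=> [endsD acyc] sc; split=> // i j k ij jk; have ik := ltn_trans ij jk.
have [nij njk nik] : [/\ i != j, j != k & i != k].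
  by rewrite !neq_ltn ij jk ik.
have uijk : uniq [:: i; j; k] by rewrite /= !inE negb_or nij nik njk.
have [aD oD] := endsD.
have ra : restriction (alpha n) i j k = [:: i; j; k].
  by apply/eqP; rewrite restrictionE // !lt_inE word_alpha !before_enum ij jk.
have ro : restriction (omega n) i j k = [:: k; j; i].
  apply/eqP; rewrite restrictionE ?perm3 ?(rev_uniq [:: i; j; k]) //.
  by rewrite !lt_inE !before_omega ij jk.
have [[s [t [sD tD rs rt]]]|[s [t [sD tD rs rt]]]] := semi_connected_side sc ij jk.
- right=> r rD; have := restriction_cases r uijk.
  rewrite !inE => /or4P[->|->|->|/or3P[/eqP rr|/eqP rr|->]]; rewrite ?orbT //;
    case: acyc; exists i, j, k; split=> //.
  + by exists (omega n), s, r; split=> //; right.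
  + by exists (alpha n), t, r; split=> //; left.
- left=> r rD; have := restriction_cases r uijk.
  rewrite !inE => /or4P[->|/eqP rr|/eqP rr|/or3P[->|->|->]]; rewrite ?orbT //;
    case: acyc; exists i, j, k; split=> //.
  + by exists (omega n), r, s; split=> //; right.
  + by exists (alpha n), r, t; split=> //; left.
Qed.

End SemiConnectedCondorcet.

(** * Chains of words compatible with a separated family *)

(** Here h is a word and G a family of subsets of its positions: the first
hypothesis says that these sets lie on the right of the word, the second one that
they are separated. A set g blocks the ascent at v if it contains v but not v.+1,
unless it is an initial segment; the claim is that some ascent is blocked by
no set, where being initial is tested on the interval from l to l + d only.

By induction, some ascent u is free in the interval without l. If a set Z blocks it
in the whole interval, Z misses l, contains everything from l.+1 to u, and
nothing beyond. Now let v be a free ascent of the interval from l to u. A set A that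
blocks it in the whole interval contains l, misses u, and contains some q beyond
u: then A and Z alternate on l < u < q. *)
Lemma free_cut (h : nat -> nat) (G : (nat -> bool) -> Prop) :
    (forall g p q, G g -> (p < q)%N -> ~~ g p -> g q -> (h p < h q)%N) ->
    (forall g g' p q r, G g -> G g' -> (p < q)%N -> (q < r)%N ->
      g p -> ~~ g q -> g r -> ~~ g' p -> g' q -> g' r) ->
  forall d l, (exists c, [/\ (l <= c)%N, (c < l + d)%N & (h c < h c.+1)%N]) ->
  exists v, [/\ (l <= v)%N, (v < l + d)%N, (h v < h v.+1)%N
    & forall g, G g -> g v -> ~~ g v.+1 ->
        forall p q, (l <= p)%N -> (p < q)%N -> (q <= l + d)%N -> g q -> g p].
Proof.
move=> G1 G2 d; have [m] := ubnP d; elim: m d => // m IH d ltd l [c [lc cd hc]].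
have [[c' [lc' c'd hc']]|noc] := pselect
    (exists c, [/\ (l.+1 <= c)%N, (c < l + d)%N & (h c < h c.+1)%N]); last first.
  have {c lc cd hc} : (h l < h l.+1)%N /\ (0 < d)%N.
    suff -> : l = c by split=> //; lia.
    by case: (ltnP l c) => ?; [case: noc; exists c | lia].
  move=> [hl d0]; exists l; split=> //; first by lia.
  move=> g Gg gl gl1 p q lp pq qd gq; apply/negPn/negP => gp.
  have lp' : (l < p)%N by rewrite ltn_neqAle lp andbT; apply: contra gp => /eqP <-.
  have := G1 _ _ _ Gg (leq_trans lp' (ltnW pq) : (l.+1 <= q)%N).
  rewrite leq_eqVlt => H; have /G1 {}H : (l.+1 < q)%N by lia.
  have {}H := H _ Gg gl1 gq.
  have desc e : (l.+1 + e <= l + d)%N -> (h (l.+1 + e) <= h l.+1)%N.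
    elim: e => [|e IHe] le_e; first by rewrite addn0.
    rewrite addnS; apply: leq_trans (IHe _); last by lia.
    rewrite leqNgt; apply/negP => he; case: noc; exists (l.+1 + e)%N; split=> //; lia.
  by have := desc (q - l.+1)%N; rewrite subnKC; lia.
have [d' dE] : exists d', d = d'.+1 by exists d.-1; lia.
have dE' : (l.+1 + d')%N = (l + d)%N by rewrite dE addnS.
have ltd' : (d' < m)%N by rewrite dE ltnS in ltd.
have [|u [lu ud hu freeu]] := IH d' ltd' l.+1.
  by exists c'; split=> //; rewrite dE'.
rewrite dE' in ud freeu.
have [//|blocked] := pselect (forall g, G g -> g u -> ~~ g u.+1 ->
  forall p q, (l <= p)%N -> (p < q)%N -> (q <= l + d)%N -> g q -> g p).
  by exists u; split=> //; exact: ltnW.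
have [Z [GZ Zu Zu1 Zl]] : exists Z, [/\ G Z, Z u, ~~ Z u.+1 & ~~ Z l].
  apply: contrapT => noZ; apply: blocked => g Gg gu gu1 p q lp pq qd gq.
  move: lp; rewrite leq_eqVlt => /predU1P[<-|lp]; last exact: (freeu g Gg gu gu1 p q).
  by apply/negPn/negP => gl; apply: noZ; exists g.
have freeZ := freeu Z GZ Zu Zu1.
have Zl1 : Z l.+1.
  move: (lu); rewrite leq_eqVlt => /predU1P[->//|lu'].
  exact: (freeZ l.+1 u (leqnn _) lu' (ltnW ud)).
have luE : (l + (u - l))%N = u by rewrite subnKC // ltnW.
have ltu : (u - l < m)%N by rewrite ltn_subLR ?(ltnW lu) //; lia.
have [|v [lv vu hv freev]] := IH (u - l)%N ltu l.
  exists l; rewrite luE; split=> //; exact: G1 GZ (ltnSn l) Zl Zl1.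
rewrite luE in vu freev.
exists v; split=> //; first exact: ltn_trans vu ud.
move=> A GA Av Av1 p q lp pq qd Aq; apply/negPn/negP => Ap.
have freeA := freev A GA Av Av1.
have Al : A l.
  move: (lv); rewrite leq_eqVlt => /predU1P[->//|lv'].
  exact: (freeA l v (leqnn _) lv' (ltnW vu)).
have Au : ~~ A u.
  move: (vu); rewrite leq_eqVlt => /predU1P[<-//|vu'].
  by apply: contra Av1 => Au; apply: (freeA v.+1 u (leqW lv) vu' (leqnn u)).
have uq : (u < q)%N.
  by rewrite ltnNge; apply: contra Ap => qu; exact: (freeA p q lp pq qu).
(* Z and A now carry the two alternating patterns on l < u < q. *)
suff Zq : Z q.
  case/negP: Zu1; move: (uq); rewrite leq_eqVlt => /predU1P[->//|uq'].
  exact: (freeZ u.+1 q (leqW lu) uq' qd).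
exact: (G2 A Z l u q).
Qed.

Section Sweep.
Variable n : nat.
Implicit Types (s t : 'S_n) (w u v : seq 'I_n) (x y i j : 'I_n) (Y Z : {set 'I_n}).

(** If all pairs x outside Y, y in Y that occur in this order in w are ascending,
reversals of ascents can still turn Y into an initial segment: in the plane, the
vertex Y is on the right of the path w, or on it. *)
Definition above w Y :=
  forall x y, before w x y -> x \notin Y -> y \in Y -> (x < y)%N.
Definition below w Y :=
  forall x y, before w x y -> x \notin Y -> y \in Y -> (y < x)%N.
Definition compatible w Y := above w Y \/ below w Y.
Definition initial w Y := forall x y, before w x y -> y \in Y -> x \in Y.

(** No triple i < j < k alternates between Y and Z: this is the strong
separation of Leclerc and Zelevinsky. *)
Definition separated (F : {set {set 'I_n}}) :=
  forall Y Z (i j k : 'I_n), Y \in F -> Z \in F -> (i < j)%N -> (j < k)%N ->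
  i \in Y -> j \notin Y -> k \in Y -> i \notin Z -> j \in Z -> k \in Z.

Lemma initial_above_below w Y : above w Y -> below w Y -> initial w Y.
Proof.
move=> aY bY x y xy yY; apply/negPn/negP => xY.
by have := aY x y xy xY yY; have := bY x y xy xY yY; lia.
Qed.

(** The only new pair that the reversal of i j creates is j before i, a
descending one. It matters only if Y contains i and not j, and then no harm is
done if Y has no other pair, that is, if it is an initial segment. *)
Lemma compatible_swap u v i j Y : let w := u ++ i :: j :: v in
    uniq w -> (i < j)%N ->
    (above w Y -> i \in Y -> j \notin Y -> initial w Y) ->
  compatible w Y -> compatible (u ++ j :: i :: v) Y.
Proof.
move=> w uw ij free cY.
have sub x y : before (u ++ j :: i :: v) x y ->
    before w x y \/ x = j /\ y = i.
  by rewrite before_swap // => /orP[/andP[/eqP-> /eqP->]|/andP[-> _]]; [right|left].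
have [/andP[iY jY]|nij] := boolP ((i \in Y) && (j \notin Y)).
  right=> x y /sub[xy|[-> -> //]] xY yY; case: cY => [aY|bY]; last exact: bY.
  by case/negP: xY; apply: (free aY iY jY) xy yY.
case: cY => [aY|bY]; [left|right] => x y /sub[xy|[-> ->]] xY yY; try by [apply: aY|apply: bY].
all: by rewrite xY yY in nij.
Qed.

(** Only the sets above w can block an ascent, so [free_cut] is applied to the
sets of positions that they occupy in w. *)
Lemma free_ascent w (F : {set {set 'I_n}}) : perm_eq w (enum 'I_n) ->
    separated F -> (forall Y, Y \in F -> compatible w Y) ->
    w != word (omega n) ->
  exists u i j v, [/\ w = u ++ i :: j :: v, (i < j)%N
    & forall Y, Y \in F -> compatible (u ++ j :: i :: v) Y].
Proof.
move=> pw sepF cF neq.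
have uw : uniq w by rewrite (perm_uniq pw) enum_uniq.
have sw : size w = n by rewrite (perm_size pw) size_enum_ord.
have [u0 [x0 [j0 [v0 [w0 ij0]]]]] := ascent_or_omega pw neq.
pose g Y p := (p < n)%N && (nth x0 w p \in Y).
pose G f := exists Y, [/\ Y \in F, above w Y & f = g Y].
pose h p : nat := nth x0 w p.
have bef p q : (p < n)%N -> (q < n)%N ->
    before w (nth x0 w p) (nth x0 w q) = (p < q)%N.
  by move=> pn qn; rewrite /before !index_uniq ?sw.
have G1 f p q : G f -> (p < q)%N -> ~~ f p -> f q -> (h p < h q)%N.
  move=> [Y [YF aY ->]] pq; rewrite /g => gp /andP[qn yY].
  have pn := ltn_trans pq qn; rewrite pn in gp.
  by apply: aY gp yY; rewrite bef.
have G2 f f' p q r : G f -> G f' -> (p < q)%N -> (q < r)%N ->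
      f p -> ~~ f q -> f r -> ~~ f' p -> f' q -> f' r.
  move=> Gf Gf' pq qr fp fq fr fp' fq'.
  have h1 := G1 _ _ _ Gf qr fq fr; have h2 := G1 _ _ _ Gf' pq fp' fq'.
  case: Gf Gf' fp fq fr fp' fq' => Y [YF _ ->] [Z [ZF _ ->]].
  rewrite /g; case: (ltnP r n) => [rn|//].
  have qn := ltn_trans qr rn; rewrite qn (ltn_trans pq qn) /=.
  exact: sepF YF ZF h2 h1.
have [|c [_ cn hc freec]] := free_cut G1 G2 (d := n.-1) (l := 0%N).
  exists (size u0); split=> //.
    by move: sw; rewrite w0 size_cat /=; lia.
  by rewrite /h w0 !nth_cat ltnn subnn [(_.+1 < _)%N]ltnNge leqnSn /= subSnn.
have [c1 c2] : (c.+1 < size w)%N /\ (c < size w)%N by rewrite sw; lia.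
have wE : w = take c w ++ nth x0 w c :: nth x0 w c.+1 :: drop c.+2 w.
  by rewrite -(drop_nth x0 c1) -(drop_nth x0 c2) cat_take_drop.
exists (take c w), (nth x0 w c), (nth x0 w c.+1), (drop c.+2 w); split=> //.
move=> Y YF; apply: compatible_swap; rewrite -?wE //; last exact: cF.
move=> aY iY jY x y xy yY.
have xw z : z \in w by rewrite (perm_mem pw) mem_enum.
have GY : G (g Y) by exists Y.
have lt_n z : (index z w < n)%N by rewrite -[X in (_ < X)%N]sw index_mem.
have cn' : (c < n)%N by lia.
have := freec _ GY _ _ (index x w) (index y w) isT xy.
rewrite /g iY (negbTE jY) cn' !andbF !lt_n !nth_index //=; apply=> //.
by have := lt_n y; lia.
Qed.


(** The position m at which the step happens determines its tile. *)
Definition swap_step m w w' := exists u i j v,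
  [/\ w = u ++ i :: j :: v, size u = m, (i < j)%N & w' = u ++ j :: i :: v].

Definition sweep N (W : nat -> seq 'I_n) (pos : nat -> nat) :=
  [/\ W 0 = enum 'I_n, W N = word (omega n)
    & forall k, (k < N)%N -> swap_step (pos k) (W k) (W k.+1)].

Lemma swap_step_perm m w w' : swap_step m w w' -> perm_eq w' w.
Proof.
move=> [u [i [j [v [-> _ _ ->]]]]]; rewrite perm_cat2l.
by apply/seq.permP => p /=; lia.
Qed.

Lemma sweep_perm N W pos : sweep N W pos ->
  forall k, (k <= N)%N -> perm_eq (W k) (enum 'I_n).
Proof.
move=> [W0 _ st]; elim=> [|k IH] kN; first by rewrite W0.
by apply: perm_trans (swap_step_perm (st k kN)) _; apply: IH; lia.
Qed.

Lemma compatible_chain (F : {set {set 'I_n}}) w : separated F ->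
    perm_eq w (enum 'I_n) -> (forall Y, Y \in F -> compatible w Y) ->
  exists N W pos, [/\ W 0 = w, W N = word (omega n),
    forall k, (k < N)%N -> swap_step (pos k) (W k) (W k.+1)
    & forall k Y, (k <= N)%N -> Y \in F -> compatible (W k) Y].
Proof.
move=> sepF; have [m] := ubnP (#|{: 'I_n * 'I_n}| - #|inversions w|).
elim: m w => // m IH w lt_m pw cF.
have [wo|neq] := eqVneq w (word (omega n)).
  exists 0%N, (fun=> w), (fun=> 0%N); split=> // k Y _; exact: cF.
have [u [i [j [v [wE ij cF']]]]] := free_ascent pw sepF cF neq.
have uw : uniq w by rewrite (perm_uniq pw) enum_uniq.
set w' := u ++ j :: i :: v in cF'.
have st : swap_step (size u) w w' by exists u, i, j, v.
have [|||N [W [pos [W0 WN stW cW]]]] := IH w'.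
- rewrite wE in uw; have [nI eI] := inversions_swap uw ij.
  have := max_card (mem (inversions w')).
  rewrite /w' eI cardsU1 nI -wE.
  by move: lt_m; move: #|inversions w| #|{: _ * _}| => a b /=; lia.
- exact: perm_trans (swap_step_perm st) pw.
- exact: cF'.
exists N.+1, (fun k => if k is k'.+1 then W k' else w),
  (fun k => if k is k'.+1 then pos k' else size u); split=> //.
- by case=> [|k]; [rewrite W0 | exact: stW].
- by case=> [|k] Y kN; [exact: cF | exact: cW].
Qed.

(** A discrete intermediate value principle. *)
Lemma chain_crossing (P : nat -> Prop) N : P 0%N -> ~ P N ->
  exists2 k, (k < N)%N & P k /\ ~ P k.+1.
Proof.
move=> P0; elim: N => // N IH PN.
have [PN'|PN'] := pselect (P N); first by exists N.
by have [k kN ?] := IH PN'; exists k => //; exact: ltnW.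
Qed.

(** A set that passes from above to below has no pair left at that moment except
the reversed one, because a pair is not both ascending and descending. *)
Lemma above_swap_lost u v i j Y : let w := u ++ i :: j :: v in
    uniq w -> (i < j)%N -> above w Y -> compatible (u ++ j :: i :: v) Y ->
    ~ above (u ++ j :: i :: v) Y ->
  [/\ initial w Y, i \in Y & j \notin Y].
Proof.
move=> w uw ij aY [//|bY] naY.
have [/andP[iY jY]|nij] := boolP ((i \in Y) && (j \notin Y)); last first.
  case: naY => x y; rewrite before_swap // => /orP[/andP[/eqP-> /eqP->]|/andP[xy _]].
    by move=> jY iY; rewrite iY jY in nij.
  exact: aY.
split=> //; apply: initial_above_below => // x y xy xY yY; apply: bY => //.
rewrite before_swap // [before _ _ _]xy /=; apply/orP; right.
by apply: contra xY => /andP[/eqP->].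
Qed.

Lemma initial_edge w Y x : perm_eq w (enum 'I_n) -> x \notin Y ->
    initial w Y -> initial w (x |: Y) ->
  exists u v, w = u ++ x :: v /\ u =i Y.
Proof.
move=> pw xY iY ixY.
have uw : uniq w by rewrite (perm_uniq pw) enum_uniq.
have inw z : z \in w by rewrite (perm_mem pw) mem_enum.
have xw := inw x.
case/splitPr: xw uw inw iY ixY {pw} => u v uw inw iY ixY; exists u, v; split=> // z.
apply/idP/idP => [zu|zY].
  have : z \in x |: Y.
    by apply: (ixY z x); rewrite ?setU11 // before_cat // mem_head.
  case/setU1P => // zx; move: uw; rewrite cat_uniq /= -zx => /and3P[_ /norP[]].
  by rewrite zu.
have := inw z; rewrite mem_cat in_cons => /or3P[//|/eqP zx|zv].
  by rewrite -zx zY in xY.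
case/negP: xY; apply: (iY x z) zY.
have -> : u ++ x :: v = (u ++ [:: x]) ++ v by rewrite -catA.
apply: before_cat; rewrite -?catA //= mem_cat mem_head orbT //.
Qed.

(** All sets are above alpha and below omega. At the last word for which Y and
x |: Y are both above, one of them is about to leave; by [above_swap_lost] it is an initial
segment of this word, and i, j are the neighbours at its end. The other one either
leaves as well, or differs from it by i or j only. *)
Lemma sweep_through_edge (F : {set {set 'I_n}}) N W pos Y x : sweep N W pos ->
    (forall k Y, (k <= N)%N -> Y \in F -> compatible (W k) Y) ->
    x \notin Y -> Y \in F -> x |: Y \in F ->
  exists k u v, [/\ (k <= N)%N, W k = u ++ x :: v & u =i Y].
Proof.
move=> sw cW xY YF xYF; have [W0 WN st] := sw.
suff [k [kN iY ixY]] : exists k,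
    [/\ (k <= N)%N, initial (W k) Y & initial (W k) (x |: Y)].
  have [u [v [Wk uY]]] := initial_edge (sweep_perm sw kN) xY iY ixY.
  by exists k, u, v.
have a0 Z : above (W 0) Z by move=> a b; rewrite W0 before_enum.
have bN Z : below (W N) Z by move=> a b; rewrite WN before_omega.
have [[aY axY]|] := pselect (above (W N) Y /\ above (W N) (x |: Y)).
  by exists N; split=> //; apply: initial_above_below.
case/(chain_crossing (P := fun k => above (W k) Y /\ above (W k) (x |: Y))).
  by split; apply: a0.
move=> k kN [[aY axY] na]; exists k; rewrite (ltnW kN).
have pk := sweep_perm sw (ltnW kN).
have [cY cxY] : compatible (W k.+1) Y /\ compatible (W k.+1) (x |: Y).
  by split; apply: cW.
have [u [i [j [v [wE _ ij w'E]]]]] := st k kN.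
have uw : uniq (W k) by rewrite (perm_uniq pk) enum_uniq.
rewrite {W0 WN st a0 bN pk} w'E wE in uw aY axY cY cxY na *.
set w := u ++ _ in uw aY axY na *.
have bij : before w i j.
  have -> : w = (u ++ [:: i]) ++ j :: v by rewrite -catA.
  by apply: before_cat; rewrite -?catA //= ?mem_cat mem_head ?orbT.
have bi z : z != i -> before w z j -> before w z i.
  by have [] := before_pair z uw.
have bj z : z != j -> before w i z -> before w j z.
  by have [] := before_pair z uw.
have [aY'|naY] := pselect (above (u ++ j :: i :: v) Y); last first.
  have [iY Yi Yj] := above_swap_lost uw ij aY cY naY; split=> //.
  have [axY'|naxY] := pselect (above (u ++ j :: i :: v) (x |: Y)); last first.
    by have [] := above_swap_lost uw ij axY cxY naxY.
  have [xj|xj] := eqVneq x j.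
    rewrite xj in xY axY cxY na axY' *.
    move=> a b ab /setU1P[bE|bY]; last by rewrite in_setU1 (iY _ _ ab bY) orbT.
    rewrite bE in ab; have [->|ai] := eqVneq a i; first by rewrite in_setU1 Yi orbT.
    by rewrite in_setU1 (iY _ _ (bi _ ai ab) Yi) orbT.
  have : (j < i)%N.
    apply: axY'; rewrite ?in_setU1 ?Yi ?orbT ?negb_or ?Yj ?[j == x]eq_sym ?xj //.
    by rewrite before_swap // !eqxx.
  by lia.
have naxY : ~ above (u ++ j :: i :: v) (x |: Y) by move=> ?; case: na.
have [ixY Yi Yj] := above_swap_lost uw ij axY cxY naxY; split=> //.
move: Yj; rewrite in_setU1 negb_or => /andP[jx jY].
have [iY|iY] := boolP (i \in Y).
  have : (j < i)%N.
    by apply: aY'; rewrite // before_swap // !eqxx.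
  by lia.
have xi : i = x by case/setU1P: Yi => // Yi; rewrite Yi in iY.
move=> a b ab bY; have := ixY a b ab.
rewrite in_setU1 bY orbT => /(_ isT) /setU1P[ax|//].
have : j \in x |: Y.
  apply: (ixY j b); last by rewrite in_setU1 bY orbT.
  apply: bj; last by rewrite xi -ax.
  by apply: contraNneq jY => <-.
by rewrite in_setU1 (negbTE jx) (negbTE jY).
Qed.

Definition prefixes (D : {set 'S_n}) : {set {set 'I_n}} :=
  [set Y : {set 'I_n} | [exists s in D, [exists m : 'I_n.+1,
     Y == [set x in take m (word s)]]]].

Lemma mem_prefixes (D : {set 'S_n}) s u v : s \in D -> word s = u ++ v ->
  [set x in u] \in prefixes D.
Proof.
move=> sD ws; rewrite inE; apply/existsP; exists s; rewrite sD /=.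
have lt_u : (size u < n.+1)%N by rewrite ltnS -[leqRHS](size_word s) ws size_cat leq_addr.
by apply/existsP; exists (Ordinal lt_u); rewrite /= ws take_size_cat.
Qed.

Lemma prefix_lt_in (D : {set 'S_n}) Y : Y \in prefixes D ->
  exists2 s, s \in D & forall x y, x \in Y -> y \notin Y -> lt_in s x y.
Proof.
rewrite inE => /existsP[s /andP[sD /existsP[m /eqP->]]]; exists s => // x y.
rewrite !inE lt_inE => xm ym; rewrite -(cat_take_drop m (word s)).
apply: before_cat => //; first by rewrite cat_take_drop word_uniq.
have : y \in word s by rewrite (perm_mem (perm_word s)) mem_enum.
by rewrite -{1}(cat_take_drop m (word s)) mem_cat (negbTE ym).
Qed.

(** If Y and Z alternate on i < j < k, the order with initial segment Y has j above i and
k, and the order with initial segment Z has j below them: this excludes the pit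
and the peak condition. *)
Lemma peak_pit_separated (D : {set 'S_n}) :
  peak_pit_domain D -> separated (prefixes D).
Proof.
move=> [_ pp] Y Z i j k /prefix_lt_in[s sD sY] /prefix_lt_in[t tD tZ] ij jk.
move=> iY jY kY iZ jZ; apply/negPn/negP => kZ.
have [nij njk nik] : [/\ i != j, j != k & i != k].
  by rewrite !neq_ltn ij jk (ltn_trans ij jk).
have uijk : uniq [:: i; j; k] by rewrite /= !inE negb_or nij nik njk.
have U (l : seq 'I_n) : perm_eq l [:: i; j; k] -> uniq l.
  by move=> /perm_uniq->.
have H r x y : x != y -> lt_in r x y -> lt_in r y x = false.
  by move=> xy rxy; apply/negbTE; rewrite lt_in_neg // eq_sym.
case: (pp i j k ij jk) => [/(_ t tD)|/(_ s sD)].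
  rewrite !inE !restrictionE ?U ?perm3 //.
  have h1 := tZ _ _ jZ iZ; have h2 := tZ _ _ jZ kZ.
  by rewrite (H t j i) 1?eq_sym // (H t j k) // !andbF.
rewrite !inE !restrictionE ?U ?perm3 //.
have h1 := sY _ _ iY jY; have h2 := sY _ _ kY jY.
by rewrite (H s i j) // (H s k j) 1?eq_sym // !andbF.
Qed.

End Sweep.

Local Open Scope ring_scope.

(** * The plane, the zonogon and its rhombi *)

Section Plane.
Variable R : realType.
Implicit Types (p q : 'rV[R]_2) (a b c : R).

Lemma xcoordD p q : xcoord (p + q) = xcoord p + xcoord q.
Proof. by rewrite /xcoord mxE. Qed.
Lemma ycoordD p q : ycoord (p + q) = ycoord p + ycoord q.
Proof. by rewrite /ycoord mxE. Qed.
Lemma xcoordZ a p : xcoord (a *: p) = a * xcoord p.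
Proof. by rewrite /xcoord mxE. Qed.
Lemma ycoordZ a p : ycoord (a *: p) = a * ycoord p.
Proof. by rewrite /ycoord mxE. Qed.
Lemma xcoordN p : xcoord (- p) = - xcoord p.
Proof. by rewrite /xcoord mxE. Qed.
Lemma ycoordN p : ycoord (- p) = - ycoord p.
Proof. by rewrite /ycoord mxE. Qed.
Lemma xcoord0 : xcoord (0 : 'rV[R]_2) = 0.
Proof. by rewrite /xcoord mxE. Qed.
Lemma ycoord0 : ycoord (0 : 'rV[R]_2) = 0.
Proof. by rewrite /ycoord mxE. Qed.

(** The horizontal direction is interior to the angle of every tile at its left
vertex, and to no angle at the other three vertices. *)
Definition east a : 'rV[R]_2 := \row_k (if k == 0 then a else 0).
Lemma xcoord_east a : xcoord (east a) = a.
Proof. by rewrite /xcoord mxE. Qed.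
Lemma ycoord_east a : ycoord (east a) = 0.
Proof. by rewrite /ycoord mxE. Qed.

Definition coordE := (xcoordD, ycoordD, xcoordN, ycoordN, xcoordZ, ycoordZ,
  xcoord0, ycoord0, xcoord_east, ycoord_east).

Lemma plane_ext p q : xcoord p = xcoord q -> ycoord p = ycoord q -> p = q.
Proof.
rewrite /xcoord /ycoord => ex ey; apply/rowP => k.
case: k => [[|[|//]]] lt_k.
  by rewrite (_ : Ordinal lt_k = 0) //; exact: val_inj.
by rewrite (_ : Ordinal lt_k = 1) //; exact: val_inj.
Qed.

Definition cross p q := xcoord p * ycoord q - ycoord p * xcoord q.

Lemma crossDr p q1 q2 : cross p (q1 + q2) = cross p q1 + cross p q2.
Proof. by rewrite /cross !coordE; ring. Qed.
Lemma crossZr p a q : cross p (a *: q) = a * cross p q.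
Proof. by rewrite /cross !coordE; ring. Qed.
Lemma cross0r p : cross p 0 = 0.
Proof. by rewrite /cross !coordE; ring. Qed.
Lemma crossvv p : cross p p = 0.
Proof. by rewrite /cross; ring. Qed.
Lemma crossC p q : cross p q = - cross q p.
Proof. by rewrite /cross; ring. Qed.

Lemma cross_sum I (r : seq I) (P : pred I) p (F : I -> 'rV[R]_2) :
  cross p (\sum_(k <- r | P k) F k) = \sum_(k <- r | P k) cross p (F k).
Proof. exact: (big_morph _ (crossDr p) (cross0r p)). Qed.
Lemma xcoord_sum I (r : seq I) (P : pred I) (F : I -> 'rV[R]_2) :
  xcoord (\sum_(k <- r | P k) F k) = \sum_(k <- r | P k) xcoord (F k).
Proof. exact: (big_morph _ xcoordD xcoord0). Qed.
Lemma ycoord_sum I (r : seq I) (P : pred I) (F : I -> 'rV[R]_2) :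
  ycoord (\sum_(k <- r | P k) F k) = \sum_(k <- r | P k) ycoord (F k).
Proof. exact: (big_morph _ ycoordD ycoord0). Qed.

End Plane.

Section Zonogon.
Variables (R : realType) (n : nat) (xi : 'I_n -> 'rV[R]_2).
Hypothesis xiP : generators xi.
Implicit Types (p q : 'rV[R]_2) (a b c : R) (i j : 'I_n) (u v w : seq 'I_n).
Implicit Types (T : seq (tile R n)) (t : tile R n).

Lemma xi_up i : 0 < ycoord (xi i).
Proof. by case: xiP. Qed.

Lemma cross_xi i j : (i < j)%N -> cross (xi i) (xi j) < 0.
Proof. by case: xiP => _ _; exact. Qed.

Lemma cross_xi_neq0 i j : i != j -> cross (xi i) (xi j) != 0.
Proof.
rewrite neq_ltn => /orP[/cross_xi/ltr0_neq0//|/cross_xi].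
by rewrite crossC oppr_lt0 => /lt0r_neq0.
Qed.

Definition psum w : 'rV[R]_2 := \sum_(i <- w) xi i.

Lemma psum_cat u v : psum (u ++ v) = psum u + psum v.
Proof. exact: big_cat. Qed.
Lemma psum_cons i v : psum (i :: v) = xi i + psum v.
Proof. exact: big_cons. Qed.
Lemma psum_nil : psum [::] = 0.
Proof. exact: big_nil. Qed.
Lemma psum_perm u v : perm_eq u v -> psum u = psum v.
Proof. by move=> uv; apply: perm_big. Qed.
Lemma psum_all w : perm_eq w (enum 'I_n) -> psum w = \sum_i xi i.
Proof. by move=> pw; rewrite (psum_perm pw) /psum big_enum. Qed.

(** The vertices are points and not sets of colors, because the tiles of a given
tiling may a priori be placed anywhere. *)
Fixpoint path_edges p w : seq ('rV[R]_2 * 'I_n) :=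
  if w is i :: w' then (p, i) :: path_edges (p + xi i) w' else [::].

Lemma path_edges_cat p u v :
  path_edges p (u ++ v) = path_edges p u ++ path_edges (p + psum u) v.
Proof.
elim: u p => [|i u IH] p /=; first by rewrite psum_nil addr0.
by rewrite IH psum_cons addrA.
Qed.

Lemma path_edgesP p w e : e \in path_edges p w ->
  exists u v, w = u ++ e.2 :: v /\ e.1 = p + psum u.
Proof.
elim: w p => //= i w IH p; rewrite in_cons => /orP[/eqP->|].
  by exists [::], w; rewrite psum_nil addr0.
by case/IH=> u [v [-> ->]]; exists (i :: u), v; rewrite psum_cons addrA.
Qed.

Lemma mem_path_edges p u i v : (p + psum u, i) \in path_edges p (u ++ i :: v).
Proof. by rewrite path_edges_cat mem_cat /= mem_head orbT. Qed.

Lemma directed_pathE T p w q : directed_path xi T p w q =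
  all (mem (graph_edges xi T)) (path_edges p w) && (p + psum w == q).
Proof.
elim: w p => [|i w IH] p /=; first by rewrite psum_nil addr0.
by rewrite IH psum_cons addrA andbA.
Qed.

Lemma snakeE T (s : 'S_n) :
  snake xi T (word s) = all (mem (graph_edges xi T)) (path_edges 0 (word s)).
Proof.
by rewrite /snake directed_pathE add0r psum_all ?perm_word // eqxx andbT.
Qed.

Lemma graph_edgesP T e : n != 1%N ->
  reflect (exists2 t, t \in T & e \in tile_edges xi t) (e \in graph_edges xi T).
Proof.
by move=> /negbTE n1; rewrite /graph_edges n1; exact: flatten_mapP.
Qed.

Lemma zonogon_convex p q a : zonogon xi p -> zonogon xi q -> 0 <= a <= 1 ->
  zonogon xi ((1 - a) *: p + a *: q).
Proof.
move=> [f f01 ->] [g g01 ->] /andP[a0 a1].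
exists (fun k => (1 - a) * f k + a * g k) => [k|].
  have /andP[f0 f1] := f01 k; have /andP[g0 g1] := g01 k.
  by apply/andP; split; nra.
rewrite !scaler_sumr -big_split; apply: eq_bigr => k _ /=.
by rewrite [RHS]scalerDl !scalerA.
Qed.

Lemma zonogon_psum u : uniq u -> zonogon xi (psum u).
Proof.
move=> uu; exists (fun k => (k \in u)%:R) => [k|]; first by case: (k \in u); rewrite ler01 lexx.
rewrite (eq_bigr (fun k => if k \in u then xi k else 0)) => [|k _].
  by rewrite -big_mkcond /psum big_uniq.
by case: (k \in u); rewrite ?scale1r ?scale0r.
Qed.

Lemma zonogon_rhombus p i j a b : 0 <= a <= 1 -> 0 <= b <= 1 ->
    zonogon xi p -> zonogon xi (p + xi i) -> zonogon xi (p + xi j) ->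
    zonogon xi (p + xi i + xi j) ->
  zonogon xi (p + a *: xi i + b *: xi j).
Proof.
move=> a01 b01 Zp Zi Zj Zij.
rewrite (_ : _ + _ = (1 - b) *: ((1 - a) *: p + a *: (p + xi i)) +
    b *: ((1 - a) *: (p + xi j) + a *: (p + xi i + xi j))).
  by do 2?[apply: zonogon_convex => //].
by apply: plane_ext; rewrite !coordE; ring.
Qed.

Lemma zonogon_psum_rhombus u i j a b : uniq [:: i, j & u] ->
  0 <= a <= 1 -> 0 <= b <= 1 -> zonogon xi (psum u + a *: xi i + b *: xi j).
Proof.
move=> uu a01 b01; move: (uu) => /= /and3P[]; rewrite inE negb_or => /andP[_ iu] ju u'.
apply: zonogon_rhombus => //; first exact: zonogon_psum.
- by rewrite addrC -psum_cons; apply: zonogon_psum; rewrite /= iu.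
- by rewrite addrC -psum_cons; apply: zonogon_psum; rewrite /= ju.
have -> : psum u + xi i + xi j = psum [:: i, j & u].
  by apply: plane_ext; rewrite !psum_cons !coordE; ring.
exact: zonogon_psum.
Qed.

(** A linear form that is positive on the colors of u, negative on those of v and zero on
xi m attains its maximum on the zonogon exactly along the segment psum u + [0, xi m]. This
describes the edges of the left side of the zonogon, for d = xi m, and of its right
side, for d = - xi m. *)
Lemma zonogon_face d u m v z : perm_eq (u ++ m :: v) (enum 'I_n) ->
    (forall k, k \in u -> 0 < cross d (xi k)) ->
    (forall k, k \in v -> cross d (xi k) < 0) ->
    cross d (xi m) = 0 -> zonogon xi z ->
  cross d z <= cross d (psum u) /\
  (cross d (psum u) <= cross d z -> exists2 c, 0 <= c <= 1 & z = psum u + c *: xi m).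
Proof.
move=> pw u_gt v_lt m0 [a a01 ->].
have uw : uniq (u ++ m :: v) by rewrite (perm_uniq pw) enum_uniq.
have /and3P[uu /norP[mu _] _] : [&& uniq u, ~~ has (mem u) (m :: v) & uniq (m :: v)].
  by rewrite -cat_uniq.
have {}mu : (m \in u) = false by exact: negbTE.
have pE : psum u = \sum_k (k \in u)%:R *: xi k.
  rewrite /psum big_uniq // big_mkcond; apply: eq_bigr => k _.
  by case: (k \in u); rewrite ?scale1r ?scale0r.
have cross_neq0 k : k != m -> cross d (xi k) != 0.
  move=> km; have : k \in u ++ m :: v by rewrite (perm_mem pw) mem_enum.
  rewrite mem_cat in_cons (negbTE km) => /orP[/u_gt|/v_lt] h; first by rewrite gt_eqF.
  by rewrite lt_eqF.
have term (k : 'I_n) : true -> 0 <= ((k \in u)%:R - a k) * cross d (xi k).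
  move=> _; have /andP[ak0 ak1] := a01 k.
  have : k \in u ++ m :: v by rewrite (perm_mem pw) mem_enum.
  rewrite mem_cat; case: (boolP (k \in u)) => [/u_gt h _|_] /=; first by nra.
  by rewrite in_cons => /orP[/eqP->|/v_lt]; [rewrite m0 mulr0 | nra].
have diff : cross d (psum u) - cross d (\sum_k a k *: xi k) =
    \sum_(k : 'I_n) ((k \in u)%:R - a k) * cross d (xi k).
  rewrite pE !cross_sum -sumrB; apply: eq_bigr => k _.
  by rewrite !crossZr mulrBl.
split; first by rewrite -subr_ge0 diff sumr_ge0.
rewrite -subr_le0 diff => le0; exists (a m) => //.
have : \sum_(k : 'I_n) ((k \in u)%:R - a k) * cross d (xi k) == 0.
  by rewrite eq_le le0 sumr_ge0.
rewrite psumr_eq0 // => /allP all0.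
rewrite pE (bigD1 m) //= [X in _ = X + _](bigD1 m) //= mu scale0r add0r.
rewrite addrC; congr (_ + _); apply: eq_bigr => k km.
have := all0 k (mem_index_enum k); rewrite /= mulf_eq0 subr_eq0.
by rewrite (negbTE (cross_neq0 k km)) orbF => /eqP <-.
Qed.

Lemma tile_coord_inj i j a b a' b' : (i < j)%N ->
  a *: xi i + b *: xi j = a' *: xi i + b' *: xi j -> a = a' /\ b = b'.
Proof.
move=> ij e; have := cross_xi ij => /ltr0_neq0 c0.
have ei : cross (xi i) (a *: xi i + b *: xi j) = cross (xi i) (a' *: xi i + b' *: xi j).
  by rewrite e.
have ej : cross (xi j) (a *: xi i + b *: xi j) = cross (xi j) (a' *: xi i + b' *: xi j).
  by rewrite e.
rewrite !crossDr !crossZr !crossvv !mulr0 ?addr0 ?add0r in ei ej.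
rewrite ![cross (xi j) _]crossC in ej.
split; [apply: (mulIf c0); apply: oppr_inj; by rewrite -!mulrN | exact: (mulIf c0)].
Qed.

Lemma edge_sub_tile t e : e \in tile_edges xi t ->
  (edge_set xi e `<=` tile_set xi t)%classic.
Proof.
case: t => -[p i] j /=; rewrite !inE; have l0 : 0 <= (0 : R) <= 1 by rewrite lexx ler01.
have l1 : 0 <= (1 : R) <= 1 by rewrite lexx ler01.
by case/or4P => /eqP-> _ [a a01 ->] /=;
  [exists a, 0 | exists 0, a | exists a, 1 | exists 1, a]; split=> //;
  rewrite ?scale0r ?scale1r ?addr0 //= -addrA ?[xi j + _]addrC ?addrA.
Qed.

(** Cramer's rule for the two coordinates along the sides of the tile. *)
Lemma tile_setP i j p q : (i < j)%N -> tile_set xi (p, i, j) q <->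
  (0 <= cross (q - p) (xi j) / cross (xi i) (xi j) <= 1) /\
  (0 <= cross (xi i) (q - p) / cross (xi i) (xi j) <= 1).
Proof.
move=> /cross_xi c_lt; have c0 := ltr0_neq0 c_lt; split.
  move=> /= [a [b [a01 b01 ->]]].
  have -> : p + a *: xi i + b *: xi j - p = a *: xi i + b *: xi j.
    by rewrite addrAC [p + _]addrC addrK.
  rewrite [cross (_ + _) _]crossC !crossDr !crossZr !crossvv !mulr0 addr0 add0r.
  by rewrite -mulrN -crossC !mulfK.
move=> [a01 b01] /=; exists (cross (q - p) (xi j) / cross (xi i) (xi j)),
  (cross (xi i) (q - p) / cross (xi i) (xi j)); split=> //.
move: c0; rewrite /cross => c0; apply: plane_ext; rewrite !coordE; field.
  by [].
by [].
Qed.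

End Zonogon.

(** * Snakes of a rhombus tiling *)

Section TilingSnakes.
Variables (R : realType) (n : nat) (xi : 'I_n -> 'rV[R]_2).
Hypothesis xiP : generators xi.
Implicit Types (p q : 'rV[R]_2) (a b c eps : R) (i j : 'I_n) (u v w : seq 'I_n).
Implicit Types (t : tile R n) (e : 'rV[R]_2 * 'I_n).

Definition on_right_side p := forall eps, 0 < eps -> ~ zonogon xi (p + east eps).

(** The points at parameters 1/2, 1/3, 1/4 and so on are pairwise distinct. *)
Lemma generic_point p i (l : seq 'rV[R]_2) :
  exists c, [/\ 0 < c, c < 1 & p + c *: xi i \notin l].
Proof.
pose f (k : nat) := p + (k.+2%:R^-1 : R) *: xi i.
have f_inj : injective f.
  move=> k m /addrI/(congr1 (@ycoord R)); rewrite !coordE.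
  move/(mulIf (lt0r_neq0 (xi_up xiP i)))/invr_inj/eqP.
  by rewrite eqr_nat => /eqP[].
have /allPn[_ /mapP[k _ ->] fk] : ~~ all (mem l) [seq f k | k <- iota 0 (size l).+1].
  apply/negP => /allP sub; have := uniq_leq_size _ sub.
  by rewrite map_inj_uniq // iota_uniq size_map size_iota ltnn => /(_ isT).
exists k.+2%:R^-1; split=> //; first by rewrite invr_gt0 ltr0n.
by rewrite invf_lt1 ?ltr0n // ltr1n.
Qed.

Lemma tile_left_vertex q i j : (i < j)%N -> exists2 d, 0 < d &
  forall eps, 0 < eps <= d -> tile_set xi (q, i, j) (q + xi i + east eps).
Proof.
move=> ij; have c0 := cross_xi xiP ij.
have [yi yj] := (xi_up xiP i, xi_up xiP j).
exists (- cross (xi i) (xi j) / (ycoord (xi i) + ycoord (xi j))).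
  by apply: divr_gt0; lra.
move=> eps /andP[e0]; rewrite ler_pdivlMr ?addr_gt0 // => e1.
apply/(tile_setP xiP) => //.
have -> : cross (q + xi i + east eps - q) (xi j) = cross (xi i) (xi j) + eps * ycoord (xi j).
  by rewrite /cross !coordE; ring.
have -> : cross (xi i) (q + xi i + east eps - q) = - (eps * ycoord (xi i)).
  by rewrite /cross !coordE; ring.
have := mulr_gt0 e0 yi; have := mulr_gt0 e0 yj.
rewrite !ler_ndivlMr ?ler_ndivrMr // !mul0r !mul1r; lra.
Qed.

Lemma tile_right_edge q i j c eps : (i < j)%N -> 0 < eps ->
  ~ tile_set xi (q, i, j) (q + c *: xi j + east eps) /\
  ~ tile_set xi (q, i, j) (q + xi j + c *: xi i + east eps).
Proof.
move=> ij e0; have c0 := cross_xi xiP ij.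
have := mulr_gt0 e0 (xi_up xiP i); have := mulr_gt0 e0 (xi_up xiP j) => ej ei.
split=> /(tile_setP xiP _ _ ij); rewrite !ler_ndivlMr ?ler_ndivrMr // !mul0r !mul1r.
  have -> : cross (q + c *: xi j + east eps - q) (xi j) = eps * ycoord (xi j).
    by rewrite /cross !coordE; ring.
  by lra.
have -> : cross (xi i) (q + xi j + c *: xi i + east eps - q) =
   cross (xi i) (xi j) - eps * ycoord (xi i).
  by rewrite /cross !coordE; ring.
by lra.
Qed.

(** The pigeonhole principle for infinitely many arbitrarily small eps. *)
Lemma small_witness (A : eqType) (l : seq A) (P : A -> R -> Prop) d : 0 < d ->
    (forall eps, 0 < eps < d -> exists2 t, t \in l & P t eps) ->
  exists2 t, t \in l & forall d', 0 < d' -> exists2 eps, 0 < eps < d' & P t eps.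
Proof.
elim: l d => [|t l IH] d d0 H.
  by have [|//] := H (d / 2); lra.
have [Pt|nPt] := pselect (forall d', 0 < d' -> exists2 eps, 0 < eps < d' & P t eps).
  by exists t; rewrite ?mem_head.
have [d1 d10 nP] : exists2 d1, 0 < d1 & forall eps, 0 < eps < d1 -> ~ P t eps.
  apply: contrapT => nd; apply: nPt => d' d'0; apply: contrapT => ne.
  by apply: nd; exists d' => // eps e0 Pe; apply: ne; exists eps.
have [||t' t'l Pt'] := IH (Num.min d d1); first by rewrite lt_min d0.
  move=> eps; rewrite lt_min => /and3P[e0 ed ed1].
  have [|t'] := H eps; first by rewrite e0.
  rewrite in_cons => /orP[/eqP-> /nP|]; first by rewrite e0 => /(_ ed1).
  by exists t'.
by exists t' => //; rewrite in_cons t'l orbT.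
Qed.

Lemma unit_interval_limit a b :
    (forall d, 0 < d -> exists2 eps, 0 < eps < d & 0 <= a + eps * b <= 1) ->
  0 <= a <= 1.
Proof.
move=> H; have b0 : 0 < `|b| + 1 by have := normr_ge0 b; lra.
have [ble bge] : b <= `|b| /\ - b <= `|b| by rewrite ler_norm -normrN ler_norm.
apply/andP; split; rewrite leNgt; apply/negP => a0.
  have [|eps /andP[e0]] := H (- a / (`|b| + 1)); first by apply: divr_gt0; lra.
  by rewrite ltr_pdivlMr // => e1 /andP[e2 _]; nra.
have [|eps /andP[e0]] := H ((a - 1) / (`|b| + 1)); first by apply: divr_gt0; lra.
by rewrite ltr_pdivlMr // => e1 /andP[_ e2]; nra.
Qed.

(** Tiles are closed. *)
Lemma tile_closed_east q i j p : (i < j)%N ->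
    (forall d, 0 < d -> exists2 eps, 0 < eps < d & tile_set xi (q, i, j) (p + east eps)) ->
  tile_set xi (q, i, j) p.
Proof.
move=> ij H; apply/(tile_setP xiP) => //; split.
  apply: (@unit_interval_limit _ (ycoord (xi j) / cross (xi i) (xi j))) => d d0.
  have [eps e0 /(tile_setP xiP _ _ ij)[h _]] := H d d0; exists eps => //.
  rewrite mulrA -mulrDl (_ : _ + _ = cross (p + east eps - q) (xi j)) //.
  by rewrite /cross !coordE; ring.
apply: (@unit_interval_limit _ (- ycoord (xi i) / cross (xi i) (xi j))) => d d0.
have [eps e0 /(tile_setP xiP _ _ ij)[_ h]] := H d d0; exists eps => //.
rewrite mulrA -mulrDl (_ : _ + _ = cross (xi i) (p + east eps - q)) //.
by rewrite /cross !coordE; ring.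
Qed.

Lemma tile_edge_coord q i j e : e \in tile_edges xi (q, i, j) ->
  (exists2 b, b = 0 \/ b = 1 & e = (q + b *: xi j, i)) \/
  (exists2 a, a = 0 \/ a = 1 & e = (q + a *: xi i, j)).
Proof.
rewrite /= !inE => /or4P[] /eqP->.
- by left; exists 0; [left | rewrite scale0r addr0].
- by right; exists 0; [left | rewrite scale0r addr0].
- by left; exists 1; [right | rewrite scale1r].
- by right; exists 1; [right | rewrite scale1r].
Qed.

Lemma tile_vertex_coord q i j p : p \in tile_vertices xi (q, i, j) ->
  exists a b, [/\ a = 0 \/ a = 1, b = 0 \/ b = 1 & p = q + a *: xi i + b *: xi j].
Proof.
rewrite /= !inE => /or4P[] /eqP->;
  [exists 0, 0 | exists 1, 0 | exists 0, 1 | exists 1, 1];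
  rewrite ?scale0r ?scale1r ?addr0; split=> //; auto.
Qed.

Lemma tile_coordI q i j a b a' b' : (i < j)%N ->
  q + a *: xi i + b *: xi j = q + a' *: xi i + b' *: xi j -> a = a' /\ b = b'.
Proof. by move=> ij; rewrite -!addrA => /addrI /(tile_coord_inj xiP ij). Qed.

Lemma tile_edge_unique q i j e e' c : (i < j)%N -> 0 < c < 1 ->
    e \in tile_edges xi (q, i, j) -> e' \in tile_edges xi (q, i, j) ->
    edge_set xi e' (e.1 + c *: xi e.2) ->
  e = e'.
Proof.
move=> ij c01 /tile_edge_coord[[b b01 ->]|[a a01 ->]]
  /tile_edge_coord[[b' b01' ->]|[a' a01' ->]] [c' _] /=.
- by rewrite [LHS]addrAC [RHS]addrAC => /(tile_coordI ij)[_ ->].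
- by rewrite [LHS]addrAC => /(tile_coordI ij)[cE _];
  move: c01; case: a01' cE => -> ->; rewrite ltxx ?andbF.
- by rewrite [RHS]addrAC => /(tile_coordI ij)[_ cE];
  move: c01; case: b01' cE => -> ->; rewrite ltxx ?andbF.
- by move/(tile_coordI ij) => [-> _].
Qed.

Lemma tile_edge_not_vertex q i j e p c : (i < j)%N -> 0 < c < 1 ->
    e \in tile_edges xi (q, i, j) -> p \in tile_vertices xi (q, i, j) ->
  p != e.1 + c *: xi e.2.
Proof.
move=> ij c01 He /tile_vertex_coord[a [b [a01 b01 ->]]]; apply/eqP.
move: He => /tile_edge_coord[[b' _ ->]|[a' _ ->]] /=.
  by rewrite [RHS]addrAC => /(tile_coordI ij)[aE _];
  move: c01; case: a01 aE => -> <-; rewrite ltxx ?andbF.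
by move/(tile_coordI ij) => [_ bE];
  move: c01; case: b01 bE => -> <-; rewrite ltxx ?andbF.
Qed.

Variable T : seq (tile R n).
Hypotheses (n_neq1 : n != 1%N) (tilT : rhombus_tiling xi T).

Lemma tile_lt q i j : (q, i, j) \in T -> (i < j)%N.
Proof. by case: tilT => + _ _ => /[apply]. Qed.

Lemma tile_sub_zonogon t : t \in T -> (tile_set xi t `<=` zonogon xi)%classic.
Proof. by case: tilT => _ /(_ n_neq1) <- _ tT p tp; exists t. Qed.

Lemma zonogon_covered p : zonogon xi p -> exists2 t, t \in T & tile_set xi t p.
Proof. by case: tilT => _ /(_ n_neq1) <- _ [t tT tp]; exists t. Qed.

Lemma left_vertex_not_right q i j : (q, i, j) \in T -> ~ on_right_side (q + xi i).
Proof.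
move=> tT; have [d d0 td] := tile_left_vertex q (tile_lt tT) => /(_ d d0); apply.
by apply: (tile_sub_zonogon tT); apply: td; rewrite d0 lexx.
Qed.

(** Both tiles contain a short horizontal segment that starts at their left
vertex; neither a vertex nor an edge contains two points of it. *)
Lemma same_left_vertex q i j q' i' j' : (q, i, j) \in T -> (q', i', j') \in T ->
  q + xi i = q' + xi i' -> (q, i, j) = (q', i', j').
Proof.
move=> tT tT' eqv; apply/eqP/negPn/negP => neq.
have [d d0 td] := tile_left_vertex q (tile_lt tT).
have [d' d0' td'] := tile_left_vertex q' (tile_lt tT').
pose e := Num.min d d'; have e0 : 0 < e by rewrite lt_min d0.
have [ed ed'] : e <= d /\ e <= d' by rewrite /e !ge_min !lexx orbT.
pose v := q + xi i.
have inI a : 0 < a <= e ->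
    (tile_set xi (q, i, j) `&` tile_set xi (q', i', j'))%classic (v + east a).
  move=> a0e; split; first by apply: td; lra.
  by rewrite /v eqv; apply: td'; lra.
have /inI I1 : 0 < e <= e by rewrite e0 lexx.
have /inI I2 : 0 < e / 2 <= e by lra.
case: tilT => _ _ /(_ _ _ tT tT' neq) []; first by exists (v + east e).
  move=> [z [_ _ E]]; rewrite E in I1 I2.
  have /(congr1 (@xcoord R)) : v + east e = v + east (e / 2) by rewrite I1 I2.
  by rewrite !coordE; lra.
move=> [z [_ _ E]]; rewrite E in I1 I2; case: I1 I2 => a _ ea [b _ eb].
have /eqP := congr1 (@ycoord R) ea; have /eqP := congr1 (@ycoord R) eb.
rewrite !coordE addr0 => /eqP-> /eqP/addrI/(mulIf (lt0r_neq0 (xi_up xiP _))) ab.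
by have := congr1 (@xcoord R) ea; rewrite -ab -eb !coordE; lra.
Qed.


Definition lower_left p i := exists j, (p, i, j) \in T.
Definition upper_left p j := exists q i, (q, i, j) \in T /\ q + xi i = p.

Lemma convex_on_right_side p q a : zonogon xi p -> zonogon xi q -> 0 < a < 1 ->
  on_right_side ((1 - a) *: p + a *: q) -> on_right_side p /\ on_right_side q.
Proof.
move=> Zp Zq a01 side; split=> eps e0 Ze.
  apply: (side ((1 - a) * eps)); first by apply: mulr_gt0; lra.
  rewrite (_ : _ + _ + _ = (1 - a) *: (p + east eps) + a *: q).
    by apply: zonogon_convex => //; lra.
  by apply: plane_ext; rewrite !coordE; ring.
apply: (side (a * eps)); first by apply: mulr_gt0; lra.
rewrite (_ : _ + _ + _ = (1 - a) *: p + a *: (q + east eps)).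
  by apply: zonogon_convex => //; lra.
by apply: plane_ext; rewrite !coordE; ring.
Qed.

(** Consider the midpoint u of the edge. If u is on the right side of the zonogon, so are
both ends by convexity. Otherwise a tile t contains points arbitrarily near to u on
its east, hence u itself. If t is not the given tile t0, they meet in a
vertex or an edge containing u, which can only be the given edge. So the edge
belongs to t, and t lies on its east. *)
Lemma edge_trichotomy p i t0 : t0 \in T -> (p, i) \in tile_edges xi t0 ->
  [\/ on_right_side p /\ on_right_side (p + xi i), lower_left p i | upper_left p i].
Proof.
move=> t0T et0; have Zt := tile_sub_zonogon t0T; have Ze := edge_sub_tile et0.
have Zpt c : 0 <= c <= 1 -> zonogon xi (p + c *: xi i).
  by move=> c01; apply/Zt/Ze; exists c.
have Zp : zonogon xi p by have := Zpt 0; rewrite scale0r addr0; apply; rewrite lexx ler01.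
have Zq : zonogon xi (p + xi i) by have := Zpt 1; rewrite scale1r; apply; rewrite lexx ler01.
pose u := p + 2^-1 *: xi i.
have uE : u = (1 - 2^-1) *: p + 2^-1 *: (p + xi i).
  by apply: plane_ext; rewrite !coordE; field.
have [side|] := pselect (on_right_side u).
  by apply: Or31; apply: (@convex_on_right_side _ _ (2^-1)) => //; [lra | rewrite -uE].
move/existsNP => [d /not_implyP[d0 /contrapT Zd]].
have [|[[q k] l] tT Ht] := @small_witness _ T (fun t eps => tile_set xi t (u + east eps)) d d0.
  move=> eps /andP[e0 ed]; apply: zonogon_covered.
  rewrite (_ : u + _ = (1 - eps / d) *: u + (eps / d) *: (u + east d)).
    apply: zonogon_convex => //; first by apply: Zpt; lra.
    by rewrite ler_pdivrMr // ler_pdivlMr //; lra.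
  by apply: plane_ext; rewrite !coordE; field; exact: lt0r_neq0.
have kl := tile_lt tT.
have tu : tile_set xi (q, k, l) u by exact: tile_closed_east.
have t0u : tile_set xi t0 u by apply: Ze; exists 2^-1 => //; lra.
have half : 0 < (2^-1 : R) < 1 by lra.
have et : (p, i) \in tile_edges xi (q, k, l).
  have [<-//|neq] := eqVneq t0 (q, k, l).
  case: tilT => _ _ /(_ _ _ t0T tT neq) []; first by exists u.
    move=> [z [zt0 _ E]].
    have uz : z = u by have : (tile_set xi t0 `&` tile_set xi (q, k, l))%classic u by []; rewrite E.
    case: t0 t0T et0 zt0 {Zt Ze t0u neq E} => -[q0 i0] j0 t0T et0 zt0.
    by have := tile_edge_not_vertex (tile_lt t0T) half et0 zt0; rewrite uz eqxx.
  move=> [z [zt0 zt E]].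
  have uz : edge_set xi z u by rewrite -E.
  case: t0 t0T et0 zt0 {Zt Ze t0u neq E} => -[q0 i0] j0 t0T et0 zt0.
  by rewrite (tile_edge_unique (tile_lt t0T) half et0 zt0 uz).
have [eps /andP[e0 _] te] := Ht 1 ltr01.
have [r1 r2] := tile_right_edge q (2^-1) kl e0.
move: et; rewrite /= !inE => /or4P[] /eqP[eq1 eq2]; subst.
- by apply: Or32; exists l.
- by case: r1.
- by case: r2.
- by apply: Or33; exists q, k.
Qed.

Lemma graph_edge_trichotomy p i : (p, i) \in graph_edges xi T ->
  [\/ on_right_side p /\ on_right_side (p + xi i), lower_left p i | upper_left p i].
Proof. by case/(graph_edgesP _ _ _ n_neq1) => t; exact: edge_trichotomy. Qed.

(** The top of a lower left edge is not on the right side of the zonogon. So the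
next edge exists and is again a lower left edge, or is an upper left edge; in the
latter case the two tiles have the same left vertex. *)
Lemma flip_after_lower_left p i w :
    all (mem (graph_edges xi T)) (path_edges xi p (i :: w)) ->
    lower_left p i -> on_right_side (p + psum xi (i :: w)) ->
  exists u k l v, i :: w = u ++ k :: l :: v /\ (p + psum xi u, k, l) \in T.
Proof.
elim: w i p => [|x w IH] i p /=.
  move=> _ [j tT]; rewrite psum_cons psum_nil addr0 => side.
  by case: (left_vertex_not_right tT).
case/and3P=> _ ex ew ll; rewrite psum_cons addrA => side.
have [j tT] := ll; have nside := left_vertex_not_right tT.
case: (graph_edge_trichotomy ex) => [[//]|ll'|[q [k [tT' eqv]]]].
  have [|u [k [l [v [-> tT']]]]] := IH x (p + xi i) _ ll' side.
    by rewrite /= ex ew.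
  by exists (i :: u), k, l, v; rewrite psum_cons addrA.
have [_ _ xj] := same_left_vertex tT' tT eqv.
by exists [::], i, x, w; rewrite psum_nil addr0 xj.
Qed.

(** As long as the vertices are on the right side, the next edge cannot be an
upper left edge. The first edge that leaves the right side is a lower left one. *)
Lemma flip_or_right p w :
    all (mem (graph_edges xi T)) (path_edges xi p w) ->
    on_right_side p -> on_right_side (p + psum xi w) ->
  (forall u v, w = u ++ v -> on_right_side (p + psum xi u)) \/
  (exists u k l v, w = u ++ k :: l :: v /\ (p + psum xi u, k, l) \in T).
Proof.
elim: w p => [|i w IH] p.
  by move=> _ sp _; left=> -[|//] v _; rewrite psum_nil addr0.
move=> all_e sp sq; have /= /andP[ei ew] := all_e.
case: (graph_edge_trichotomy ei) => [[_ si]|ll|[q [k [tT eqv]]]].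
- have [|all_r|[u [k [l [v [-> tT]]]]]] := IH (p + xi i) ew si.
  + by rewrite -addrA -psum_cons.
  + left=> -[|j u] v; first by rewrite psum_nil addr0.
    by case=> <- /all_r; rewrite psum_cons addrA.
  + by right; exists (i :: u), k, l, v; rewrite psum_cons addrA.
- by right; exact: flip_after_lower_left.
- by case: (left_vertex_not_right tT); rewrite eqv.
Qed.

Lemma bottom_on_right_side : on_right_side 0.
Proof.
move=> eps e0 [a a01 eqv].
have := congr1 (@ycoord R) eqv; rewrite !coordE addr0 ycoord_sum => /esym/eqP.
have pos k : true -> 0 <= ycoord (a k *: xi k).
  by move=> _; rewrite coordE mulr_ge0 ?(ltW (xi_up xiP k)) //; case/andP: (a01 k).
rewrite psumr_eq0 // => /allP all0.
have := congr1 (@xcoord R) eqv; rewrite !coordE add0r xcoord_sum big1; first by lra.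
move=> k _; have := all0 k (mem_index_enum k); rewrite /= !coordE.
by rewrite mulf_eq0 [ycoord _ == 0]gt_eqF ?(xi_up xiP) // orbF => /eqP->; rewrite mul0r.
Qed.

Lemma top_on_right_side : on_right_side (\sum_i xi i).
Proof.
move=> eps e0 [a a01 eqv].
have eqv' : east eps + \sum_k (1 - a k) *: xi k = 0.
  rewrite (eq_bigr (fun k => xi k - a k *: xi k)) => [|k _].
    rewrite sumrB -eqv opprD; set S := \sum_i _.
    by rewrite [S + _]addrA subrr add0r subrr.
  by rewrite scalerBl scale1r.
have := congr1 (@ycoord R) eqv'; rewrite !coordE add0r ycoord_sum => /eqP.
have pos k : true -> 0 <= ycoord ((1 - a k) *: xi k).
  move=> _; rewrite coordE mulr_ge0 ?(ltW (xi_up xiP k)) //.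
  by rewrite subr_ge0; case/andP: (a01 k).
rewrite psumr_eq0 // => /allP all0.
have := congr1 (@xcoord R) eqv'; rewrite !coordE xcoord_sum big1; first by lra.
move=> k _; have := all0 k (mem_index_enum k); rewrite /= !coordE.
by rewrite mulf_eq0 [ycoord _ == 0]gt_eqF ?(xi_up xiP) // orbF => /eqP->; rewrite mul0r.
Qed.

(** At an ascent the two edges of the snake span a rhombus contained in the
zonogon, so the vertex between them is not on the right side. *)
Lemma snake_flip (s : 'S_n) : snake xi T (word s) -> s != omega n ->
  exists u k l v, word s = u ++ k :: l :: v /\ (psum xi u, k, l) \in T.
Proof.
rewrite snakeE // => all_e neq.
have sw : psum xi (word s) = \sum_i xi i by rewrite psum_all ?perm_word.
have [||all_r|[u [k [l [v []]]]]] := flip_or_right all_e.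
- exact: bottom_on_right_side.
- by rewrite add0r sw; exact: top_on_right_side.
- have [|u [i [j [v [ws ij]]]]] := ascent_or_omega (perm_word s).
    by apply: contra neq => /eqP/word_inj->.
  have uw := word_uniq s; rewrite ws in uw.
  have [d d0 td] := tile_left_vertex (psum xi u) ij.
  case: (all_r (u ++ [:: i]) (j :: v) _ d d0); first by rewrite ws -catA.
  have := td d; rewrite d0 lexx => /(_ isT) [a [b [a01 b01]]].
  rewrite add0r psum_cat psum_cons psum_nil addr0 => ->.
  apply: (zonogon_psum_rhombus) => //.
  move: uw; rewrite cat_uniq /= !inE !negb_or.
  by case/and3P=> -> /and3P[-> -> _] /and3P[/andP[-> _] _ _].
by rewrite add0r => ws tT; exists u, k, l, v.
Qed.

Lemma snake_swap (s s' : 'S_n) u k l v : word s = u ++ k :: l :: v ->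
    word s' = u ++ l :: k :: v -> (psum xi u, k, l) \in T ->
  snake xi T (word s) -> snake xi T (word s').
Proof.
move=> ws ws' tT; rewrite !snakeE // ws ws' !path_edges_cat !all_cat /= add0r.
case/and4P=> -> _ _; rewrite addrAC => -> /=; rewrite andbT.
have inG e : e \in tile_edges xi (psum xi u, k, l) -> e \in graph_edges xi T.
  by move=> et; apply/graph_edgesP => //; exists (psum xi u, k, l).
by rewrite !inG //= !inE eqxx ?orbT.
Qed.

(** The linear form psi is maximal on the zonogon along the edge of color m of its left side. A
point of this edge that is not a vertex of a tile lies in a tile t. Moving it inside t
along xi i or xi j does not increase psi, which forces i = m or j = m and places
the point on an edge of t of color m; as this edge lies in the same face of the zonogon
and has the same length, it is the given edge. *)
Lemma alpha_edge u m v : perm_eq (u ++ m :: v) (enum 'I_n) ->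
    (forall x, x \in u -> (x < m)%N) -> (forall x, x \in v -> (m < x)%N) ->
  (psum xi u, m) \in graph_edges xi T.
Proof.
move=> pw lt_u lt_v; pose p := psum xi u.
have uw : uniq (u ++ m :: v) by rewrite (perm_uniq pw) enum_uniq.
have /and3P[uu /norP[mu _] _] : [&& uniq u, ~~ has (mem u) (m :: v) & uniq (m :: v)].
  by rewrite -cat_uniq.
pose psi := cross (xi m).
have psiD q1 q2 : psi (q1 + q2) = psi q1 + psi q2 by exact: crossDr.
have psiZ a q : psi (a *: q) = a * psi q by exact: crossZr.
have face z : zonogon xi z -> psi z <= psi p /\
    (psi p <= psi z -> exists2 c, 0 <= c <= 1 & z = p + c *: xi m).
  apply: (zonogon_face pw) => [k /lt_u km|k /lt_v mk|].
  - by rewrite crossC oppr_gt0; exact: cross_xi.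
  - exact: cross_xi.
  - exact: crossvv.
have le_psi z : zonogon xi z -> psi z <= psi p by case/face.
have on_face z : zonogon xi z -> psi p <= psi z ->
    exists2 c, 0 <= c <= 1 & z = p + c *: xi m.
  by case/face.
have psi_m : psi (xi m) = 0 by exact: crossvv.
have Zp : zonogon xi p by exact: zonogon_psum.
have Zpm : zonogon xi (p + xi m).
  rewrite addrC -psum_cons; apply: zonogon_psum; rewrite /= uu andbT.
  exact: mu.
have [c [c0 c1 cgen]] := generic_point p m (flatten [seq tile_vertices xi t | t <- T]).
have Zc : zonogon xi (p + c *: xi m).
  rewrite (_ : p + _ = (1 - c) *: p + c *: (p + xi m)).
    by apply: zonogon_convex => //; rewrite !ltW.
  by apply: plane_ext; rewrite !coordE; ring.
have [[[q i] j] tT tc] := zonogon_covered Zc.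
have ij := tile_lt tT; have Zt := tile_sub_zonogon tT.
suff [q' et psiq] : exists2 q', (q', m) \in tile_edges xi (q, i, j) & psi q' = psi p.
  have Ze := edge_sub_tile et.
  have Zq : zonogon xi q'.
    by apply/Zt/Ze; exists 0; rewrite ?lexx ?ler01 // scale0r addr0.
  have Zqm : zonogon xi (q' + xi m).
    by apply/Zt/Ze; exists 1; rewrite ?lexx ?ler01 // scale1r.
  have [|b b01 qE] := on_face _ Zq; first by rewrite psiq.
  have [|b' b01' qmE] := on_face _ Zqm; first by rewrite psiD psi_m psiq addr0.
  have bE : b + 1 = b'.
    have /(congr1 (@ycoord R)) := qmE; rewrite qE !coordE => yE.
    apply: (mulIf (lt0r_neq0 (xi_up xiP m))); lra.
  have b0 : b = 0 by lra.
  rewrite -/p; have -> : p = q' by rewrite qE b0 scale0r addr0.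
  by apply/graph_edgesP => //; exists (q, i, j).
case: (tc) => a [b [a01 b01 cE]].
have Zab a' b' : 0 <= a' <= 1 -> 0 <= b' <= 1 -> psi (q + a' *: xi i + b' *: xi j) <= psi p.
  by move=> a01' b01'; apply/le_psi/Zt; exists a', b'.
have psiE : psi p = psi q + a * psi (xi i) + b * psi (xi j).
  by rewrite -!psiZ -!psiD -cE psiD psiZ psi_m mulr0 addr0.
have l0 : 0 <= (0 : R) <= 1 by rewrite lexx ler01.
have l1 : 0 <= (1 : R) <= 1 by rewrite lexx ler01.
have ai k : k != m -> psi (xi k) != 0 by move=> km; apply: cross_xi_neq0; rewrite // eq_sym.
have {ai} aE : i != m -> a = 0 \/ a = 1.
  move=> /ai; rewrite neq_lt; have := Zab 0 b l0 b01; have := Zab 1 b l1 b01.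
  rewrite !psiD !psiZ psiE mul1r mul0r => h1 h0 /orP[] h; [left|right]; nra.
have bE : j != m -> b = 0 \/ b = 1.
  move=> jm; have := cross_xi_neq0 xiP (i := m) (j := j); rewrite eq_sym => /(_ jm).
  rewrite -/psi neq_lt; have := Zab a 0 a01 l0; have := Zab a 1 a01 l1.
  rewrite !psiD !psiZ psiE mul1r mul0r => h1 h0 /orP[] h; [left|right]; nra.
have [im|im] := eqVneq i m.
  have jm : j != m by rewrite -im neq_ltn ij orbT.
  exists (q + b *: xi j).
    by rewrite im /= !inE; case: (bE jm) => ->;
      rewrite ?scale0r ?scale1r ?addr0 eqxx ?orbT.
  by rewrite psiD psiZ psiE im psi_m mulr0 addr0.
have [jm|jm] := eqVneq j m.
  exists (q + a *: xi i).
    by rewrite jm /= !inE; case: (aE im) => ->;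
      rewrite ?scale0r ?scale1r ?addr0 eqxx ?orbT.
  by rewrite psiD psiZ psiE jm psi_m mulr0 addr0.
case/negP: cgen; apply/flatten_mapP; exists (q, i, j) => //; rewrite cE /= !inE.
by case: (aE im) => ->; case: (bE jm) => ->;
  rewrite ?scale0r ?scale1r ?addr0 eqxx ?orbT.
Qed.

Lemma snake_alpha : snake xi T (word (alpha n)).
Proof.
rewrite snakeE // word_alpha; apply/allP => e /path_edgesP[u [v [wE eE]]].
rewrite add0r in eE; have -> : e = (psum xi u, e.2) by rewrite -eE -surjective_pairing.
have bef x y : before (u ++ e.2 :: v) x y -> (x < y)%N by rewrite -wE before_enum.
have uw : uniq (u ++ e.2 :: v) by rewrite -wE enum_uniq.
apply: (@alpha_edge u e.2 v); first by rewrite -wE.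
  by move=> x xu; apply: bef; apply: before_cat; rewrite ?mem_head.
move=> x xv; apply: bef; have E : u ++ e.2 :: v = (u ++ [:: e.2]) ++ v by rewrite -catA.
by rewrite E; apply: before_cat; rewrite -?E // mem_cat mem_head orbT.
Qed.

Lemma snake_to_omega (s : 'S_n) : snake xi T (word s) ->
  exists p : seq 'S_n, [/\ path (@bruhat n) s p, last s p = omega n
    & all (mem (Sigma xi T)) (s :: p)].
Proof.
have [m] := ubnP (#|{: 'I_n * 'I_n}| - #|Inv s|).
elim: m s => // m IH s lt_m sn.
have sD : s \in Sigma xi T by rewrite inE.
have [so|neq] := eqVneq s (omega n).
  by exists [::]; split; rewrite //= sD.
have [u [k [l [v [ws tT]]]]] := snake_flip sn neq; have kl := tile_lt tT.
have [s' ws'] : exists s' : 'S_n, word s' = u ++ l :: k :: v.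
  apply: word_surj; apply: perm_trans (perm_word s); rewrite ws perm_cat2l.
  by apply/seq.permP => f /=; lia.
have cov := covers_swap kl ws ws'.
have [||p [pp pl pD]] := IH s'; last first.
- by exists (s' :: p); rewrite /= /bruhat cov; split=> //; rewrite sD.
- exact: snake_swap ws ws' tT sn.
have /existsP[e /andP[eI /eqP eqI]] := cov.
have := max_card (mem (Inv s')); rewrite eqI cardsU1 eI.
by move: lt_m; move: #|Inv s| #|{: _ * _}| => x y /=; lia.
Qed.

End TilingSnakes.

(** * Paths as graphs of functions of the height *)

Section SweepTiling.
Variables (R : realType) (n : nat) (xi : 'I_n -> 'rV[R]_2).
Hypothesis xiP : generators xi.
Implicit Types (p q : 'rV[R]_2) (a x y : R) (i j : 'I_n) (u v w : seq 'I_n).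

Definition height w : R := ycoord (psum xi w).
Local Notation X i := (xcoord (xi i)).
Local Notation Y i := (ycoord (xi i)).

Lemma height_nil : height [::] = 0.
Proof. by rewrite /height psum_nil coordE. Qed.
Lemma height_cons i w : height (i :: w) = Y i + height w.
Proof. by rewrite /height psum_cons coordE. Qed.
Lemma height_cat u v : height (u ++ v) = height u + height v.
Proof. by rewrite /height psum_cat coordE. Qed.
Lemma height_perm u v : perm_eq u v -> height u = height v.
Proof. by rewrite /height => /psum_perm->. Qed.
Lemma height_ge0 w : 0 <= height w.
Proof.
elim: w => [|i w IH]; first by rewrite height_nil.
by rewrite height_cons addr_ge0 // ltW // xi_up.
Qed.
Lemma height_gt0 i w : 0 < height (i :: w).
Proof. by rewrite height_cons ltr_wpDr ?height_ge0 // xi_up. Qed.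

(** The abscissa at height y of the path of w. Below height 0 the value is that of the line
of the first edge, above the top it is constant; only heights y >= 0 are considered. *)
Fixpoint path_x w y : R :=
  if w is i :: w' then
    if y <= Y i then y / Y i * X i else X i + path_x w' (y - Y i)
  else 0.

Lemma path_x0 w : path_x w 0 = 0.
Proof. by case: w => //= i w; rewrite ltW ?xi_up // !mul0r. Qed.

Lemma path_x_low u w y : 0 <= y <= height u -> path_x (u ++ w) y = path_x u y.
Proof.
elim: u y => [|i u IH] y /=.
  rewrite height_nil => y00; have -> : y = 0 by lra.
  by rewrite path_x0.
rewrite height_cons => yu; case: ifP => // /negbT; rewrite -ltNge => yi.
by rewrite IH //; lra.
Qed.

Lemma path_x_high u w y : height u <= y ->
  path_x (u ++ w) y = xcoord (psum xi u) + path_x w (y - height u).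
Proof.
elim: u y => [|i u IH] y /=; first by rewrite height_nil psum_nil coordE subr0 add0r.
have yi0 := xi_up xiP i.
rewrite height_cons psum_cons coordE => yu; case: ifP => yi; last first.
  by rewrite IH; [rewrite opprD !addrA | lra].
case: u {IH} yu => [|j u] yu; last by have := height_gt0 j u; lra.
have -> : y = Y i by move: yu; rewrite height_nil; lra.
by rewrite height_nil psum_nil coordE !addr0 subrr path_x0 addr0 divff ?mul1r ?gt_eqF.
Qed.

Lemma path_x_on u i v a : 0 <= a <= 1 ->
  path_x (u ++ i :: v) (height u + a * Y i) = xcoord (psum xi u) + a * X i.
Proof.
move=> a01; have yi0 := xi_up xiP i.
have ay : 0 <= a * Y i <= Y i by nra.
rewrite path_x_high; last by lra.
have -> : height u + a * Y i - height u = a * Y i by ring.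
by case/andP: ay => _ /= ->; rewrite mulfK ?gt_eqF.
Qed.

Lemma path_point w y : w != [::] -> 0 <= y <= height w ->
  exists u i v a, [/\ w = u ++ i :: v, 0 <= a <= 1 & y = height u + a * Y i].
Proof.
elim: w y => // i w IH y _; have yi0 := xi_up xiP i.
rewrite height_cons => yw; have [yi|yi] := lerP y (Y i).
  exists [::], i, w, (y / Y i); split=> //.
    by rewrite ler_pdivrMr // ler_pdivlMr // mul0r mul1r; lra.
  by rewrite height_nil add0r mulfVK ?gt_eqF.
have wN : w != [::].
  by apply: contraTneq yw => ->; rewrite height_nil; apply/negP; lra.
have [|u [j [v [a [-> a01 yE]]]]] := IH (y - Y i) wN; first by lra.
by exists (i :: u), j, v, a; split=> //; rewrite height_cons; lra.
Qed.

Lemma slopes i j : (i < j)%N -> exists r s,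
  [/\ r < s, X i = r * Y i, X j = s * Y j, forall y, y / Y i * X i = y * r &
      forall y, y / Y j * X j = y * s].
Proof.
move=> /(cross_xi xiP); rewrite /cross => c0.
have [yi yj] := (xi_up xiP i, xi_up xiP j).
exists (X i / Y i), (X j / Y j); rewrite !mulfVK ?gt_eqF //; split=> //.
- by rewrite ltr_pdivrMr // mulrAC ltr_pdivlMr //; lra.
- by move=> y; field; rewrite gt_eqF.
- by move=> y; field; rewrite gt_eqF.
Qed.

(** With the slopes r < s of xi i and xi j, the left side of the rhombus is the maximum of
the lines carrying its two edges, and the right side is a minimum. *)
Lemma path_x_pair i j : (i < j)%N -> exists r s,
  [/\ r < s, X i = r * Y i, X j = s * Y j &
      forall v y, 0 <= y <= Y i + Y j ->
        path_x (i :: j :: v) y = Num.max (y * r) (Y i * r + (y - Y i) * s) /\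
        path_x (j :: i :: v) y = Num.min (y * s) (Y j * s + (y - Y j) * r)].
Proof.
move=> ij; have [r [s [rs Xi Xj sli slj]]] := slopes ij.
exists r, s; split=> // v y /andP[y0 y1] /=; rewrite !sli !slj Xi Xj.
split; case: ifP => [le|/negbT].
- by rewrite max_l //; nra.
- by rewrite -ltNge => lt; rewrite max_r; [rewrite ifT; lra | nra].
- by rewrite min_l //; nra.
- by rewrite -ltNge => lt; rewrite min_r; [rewrite ifT; lra | nra].
Qed.

Lemma path_x_swap u v i j y : (i < j)%N -> 0 <= y ->
  let w := u ++ i :: j :: v in let w' := u ++ j :: i :: v in
  [/\ path_x w y <= path_x w' y,
      height u < y -> y < height u + Y i + Y j -> path_x w y < path_x w' y
    & ~ (height u < y < height u + Y i + Y j) -> path_x w y = path_x w' y].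
Proof.
move=> ij y0 w w'; have [yu|uy] := lerP y (height u).
  rewrite /w /w' !path_x_low ?y0 //; split=> //; lra.
have uy' := ltW uy; have [yi yj] := (xi_up xiP i, xi_up xiP j).
have [y_top|y_high] := lerP y (height u + Y i + Y j); last first.
  rewrite /w /w' -[i :: j :: v]/([:: i; j] ++ v) -[j :: i :: v]/([:: j; i] ++ v) !catA.
  have eqh : height (u ++ [:: j; i]) = height (u ++ [:: i; j]).
    by rewrite !height_cat !height_cons; lra.
  have hi : height (u ++ [:: i; j]) <= y.
    by rewrite height_cat !height_cons height_nil; lra.
  rewrite !path_x_high ?eqh // (_ : psum xi (u ++ [:: j; i]) = psum xi (u ++ [:: i; j])).
    by split=> //; lra.
  by apply: psum_perm; rewrite perm_cat2l; apply/seq.permP => f /=; lia.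
have [r [s [rs _ _ arcs]]] := path_x_pair ij.
rewrite /w /w' !path_x_high //.
have [|-> ->] := arcs v (y - height u); first by lra.
have [s1 s2 s3] : [/\ 0 < (y - height u) * (s - r), 0 < Y i * (s - r) & 0 < Y j * (s - r)].
  by split; apply: mulr_gt0; lra.
have s4 : 0 <= (height u + Y i + Y j - y) * (s - r) by apply: mulr_ge0; lra.
rewrite lerD2l ltrD2l; split.
- by rewrite ge_max !le_min -!andbA; apply/and4P; split; lra.
- move=> _ yl; have s5 : 0 < (height u + Y i + Y j - y) * (s - r) by apply: mulr_gt0; lra.
  by rewrite gt_max !lt_min -!andbA; apply/and4P; split; lra.
move=> out; have y_top' : y = height u + Y i + Y j.
  by apply/eqP; rewrite eq_le y_top leNgt; apply/negP => yl; apply: out; lra.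
by rewrite max_r ?min_r y_top'; lra.
Qed.

Lemma tile_between u v i j p : (i < j)%N -> tile_set xi (psum xi u, i, j) p ->
  height u <= ycoord p <= height u + Y i + Y j /\
  path_x (u ++ i :: j :: v) (ycoord p) <= xcoord p <=
  path_x (u ++ j :: i :: v) (ycoord p).
Proof.
move=> ij [a [b [a01 b01 pE]]].
have [yi yj] := (xi_up xiP i, xi_up xiP j).
have yE : ycoord p = height u + (a * Y i + b * Y j).
  by rewrite pE !coordE addrA.
have xE : xcoord p = xcoord (psum xi u) + (a * X i + b * X j).
  by rewrite pE !coordE addrA.
have [ay by_] : 0 <= a * Y i <= Y i /\ 0 <= b * Y j <= Y j by split; nra.
split; first by lra.
have yu : height u <= ycoord p by lra.
rewrite !path_x_high // xE !lerD2l yE addrC addKr {yE xE yu pE}.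
have [r [s [rs Xi Xj arcs]]] := path_x_pair ij.
have [|-> ->] := arcs v (a * Y i + b * Y j); first by lra.
rewrite Xi Xj (_ : a * (r * Y i) = a * Y i * r); last by ring.
rewrite (_ : b * (s * Y j) = b * Y j * s); last by ring.
have [s1 s2 s3 s4] : [/\ 0 <= a * Y i * (s - r), 0 <= b * Y j * (s - r),
    0 <= (Y i - a * Y i) * (s - r) & 0 <= (Y j - b * Y j) * (s - r)].
  by split; apply: mulr_ge0; lra.
by rewrite ge_max le_min -!andbA; apply/and4P; split; lra.
Qed.

(** The strict inequality excludes the heights outside the range of the tile,
where both paths coincide. *)
Lemma between_tile u v i j p : (i < j)%N -> 0 <= ycoord p ->
    path_x (u ++ i :: j :: v) (ycoord p) < xcoord p <=
    path_x (u ++ j :: i :: v) (ycoord p) ->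
  tile_set xi (psum xi u, i, j) p.
Proof.
move=> ij y0 xp.
have [_ _ eq] := path_x_swap u v ij y0.
have hy : height u < ycoord p < height u + Y i + Y j.
  by apply: contrapT => /eq e; rewrite e in xp; lra.
have yu : height u <= ycoord p by lra.
rewrite !path_x_high // in xp.
set y := ycoord p - height u in xp; have yE : ycoord p = height u + y by rewrite /y; ring.
set x := xcoord p - xcoord (psum xi u).
have xE : xcoord p = xcoord (psum xi u) + x by rewrite /x; ring.
have [yi yj] := (xi_up xiP i, xi_up xiP j).
have [r [s [rs Xi Xj arcs]]] := path_x_pair ij.
move: xp; have [|-> ->] := arcs v y; first by lra.
rewrite xE lerD2l ltrD2l gt_max le_min -!andbA => /and4P[x1 x2 x3 x4].
have sr : 0 < s - r by lra.
exists ((y * s - x) / (Y i * (s - r))), ((x - y * r) / (Y j * (s - r))); split.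
- by rewrite ler_pdivrMr ?mulr_gt0 // ler_pdivlMr ?mulr_gt0 //; lra.
- by rewrite ler_pdivrMr ?mulr_gt0 // ler_pdivlMr ?mulr_gt0 //; lra.
have [n1 n2 n3] : [/\ Y i != 0, Y j != 0 & s - r != 0] by rewrite !gt_eqF.
apply: plane_ext; rewrite !coordE ?xE ?Xi ?Xj -/(height u).
  by field; rewrite n1 n2 n3.
rewrite yE; clearbody x y.
by field; rewrite n1 n2 n3.
Qed.

Definition tile_at (x0 : 'I_n) w m : tile R n :=
  (psum xi (take m w), nth x0 w m, nth x0 w m.+1).

Lemma tile_at_pair (x0 : 'I_n) u i j v : tile_at x0 (u ++ i :: j :: v) (size u) = (psum xi u, i, j).
Proof.
by rewrite /tile_at take_size_cat // !nth_cat ltnn subnn [(_.+1 < _)%N]ltnNge leqnSn subSnn.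
Qed.

Lemma height_take_lt w (b b' : nat) : (b < b')%N -> (b' <= size w)%N ->
  height (take b w) < height (take b' w).
Proof.
move=> bb' b'w; rewrite -(subnKC (ltnW bb')) takeD height_cat ltrDl.
case E: (take _ _) => [|i s]; last exact: height_gt0.
by move/(congr1 size): E; rewrite size_take size_drop /=; case: ifP; lia.
Qed.

Lemma height_take_le_inv w (b b' : nat) : height (take b w) <= height (take b' w) ->
  (b <= size w)%N -> (b <= b')%N.
Proof.
move=> le bw; rewrite leqNgt; apply/negP => b'b.
by have := height_take_lt b'b bw; lra.
Qed.

Lemma take_pair (u v : seq 'I_n) i j : let w := u ++ i :: j :: v in
  [/\ take (size u) w = u, take (size u).+1 w = u ++ [:: i]
    & take (size u).+2 w = u ++ [:: i; j]].
Proof.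
move=> w; rewrite /w; split; first by rewrite take_size_cat.
  rewrite -[i :: j :: v]/([:: i] ++ j :: v) catA take_size_cat //.
  by rewrite size_cat addn1.
rewrite -[i :: j :: v]/([:: i; j] ++ v) catA take_size_cat //.
by rewrite size_cat addn2.
Qed.

Lemma height_window u i j v (b : nat) y : let w := u ++ i :: j :: v in
    height u <= y <= height u + Y i + Y j -> (b <= size w)%N ->
    height (take b w) = y -> (size u <= b <= (size u).+2)%N.
Proof.
move=> w yu bw by_; have [t0 t1 t2] := take_pair u v i j.
apply/andP; split.
  apply: (@height_take_le_inv w); rewrite ?size_cat ?leq_addr // t0 by_; lra.
apply: (@height_take_le_inv w); rewrite // t2 by_ height_cat !height_cons height_nil; lra.
Qed.

Lemma height_window_edge u i j v (b : nat) y : let w := u ++ i :: j :: v in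
    height u <= y <= height u + Y i + Y j -> (b < size w)%N ->
    height (take b w) < y < height (take b.+1 w) -> (size u <= b <= (size u).+1)%N.
Proof.
move=> w yu bw by_; have [t0 t1 t2] := take_pair u v i j.
apply/andP; split; rewrite leqNgt; apply/negP => lt_b.
  have : height (take b.+1 w) <= height u.
    rewrite -[in leRHS]t0 -/w; move: lt_b; rewrite leq_eqVlt => /orP[/eqP->//|lt_b].
    by apply/ltW/height_take_lt; rewrite // /w size_cat leq_addr.
  by lra.
have : height u + Y i + Y j <= height (take b w).
  have -> : height u + Y i + Y j = height (take (size u).+2 w).
    by rewrite t2 height_cat !height_cons height_nil; ring.
  move: lt_b; rewrite leq_eqVlt => /orP[/eqP->//|lt_b].
  by apply/ltW/height_take_lt; rewrite // ltnW.
by lra.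
Qed.

Lemma swap_take_perm u v i j (b : nat) : b != (size u).+1 ->
  perm_eq (take b (u ++ i :: j :: v)) (take b (u ++ j :: i :: v)).
Proof.
move=> bu; rewrite !take_cat; case: ltnP => // ub; rewrite perm_cat2l.
have [->|[d ->]] : b = size u \/ exists d, b = (size u + d.+2)%N.
  have [->|neq] := eqVneq b (size u); [by left|right]; exists (b - (size u).+2)%N.
  by move: bu neq ub; move: (size u) => s; lia.
- by rewrite subnn.
by rewrite addKn /=; apply/seq.permP => f /=; lia.
Qed.

Lemma rcons_perm_last (u u' : seq 'I_n) i i' : perm_eq u u' ->
  perm_eq (rcons u i) (rcons u' i') -> i = i'.
Proof.
move=> uu'; rewrite -!cats1 => ii'.
have : perm_eq (u' ++ [:: i]) (u' ++ [:: i']).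
  by apply: perm_trans ii'; rewrite perm_cat2r perm_sym.
by rewrite perm_cat2l => /perm_mem/(_ i); rewrite !inE eqxx => /esym/eqP.
Qed.

(** * The tiling swept out by a chain of words *)

Variables (x0 : 'I_n) (N : nat) (W : nat -> seq 'I_n) (pos : nat -> nat).
Hypotheses (sw : sweep N W pos) (n_neq1 : n != 1%N).

Definition sweep_tiles : seq (tile R n) := [seq tile_at x0 (W k) (pos k) | k <- iota 0 N].

Lemma sweep_step k : (k < N)%N -> exists u i j v,
  [/\ W k = u ++ i :: j :: v, W k.+1 = u ++ j :: i :: v, size u = pos k, (i < j)%N
    & tile_at x0 (W k) (pos k) = (psum xi u, i, j)].
Proof.
case: sw => _ _ st /st[u [i [j [v [Wk su ij Wk']]]]]; exists u, i, j, v; split=> //.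
by rewrite Wk -su tile_at_pair.
Qed.

Lemma sweep_size k : (k <= N)%N -> size (W k) = n.
Proof. by move=> kN; rewrite (perm_size (sweep_perm sw kN)) size_enum_ord. Qed.

Lemma path_x_mono k l y : 0 <= y -> (k <= l)%N -> (l <= N)%N ->
  path_x (W k) y <= path_x (W l) y.
Proof.
move=> y0; elim: l => [|l IH]; first by rewrite leqn0 => /eqP->.
rewrite leq_eqVlt => /orP[/eqP->//|]; rewrite ltnS => kl lN.
apply: le_trans (IH kl (ltnW lN)) _.
have [u [i [j [v [-> -> _ ij _]]]]] := sweep_step lN.
by have [] := path_x_swap u v ij y0.
Qed.

Lemma sweep_outside k u i j v y : (k < N)%N -> 0 <= y -> (i < j)%N ->
    W k = u ++ i :: j :: v -> W k.+1 = u ++ j :: i :: v ->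
    path_x (W k) y = path_x (W k.+1) y ->
  ~ (height u < y < height u + Y i + Y j).
Proof.
move=> kN y0 ij -> -> eqx /andP[yl yu].
by have [_ /(_ yl yu)] := path_x_swap u v ij y0; rewrite eqx ltxx.
Qed.

(** The two paths agree at height y, so by monotonicity all intermediate paths do, and
no reversal in between has y strictly inside its range. A vertex at height y is
thus never moved. *)
Lemma vertex_persists k l (b : nat) y : 0 <= y -> (k <= l)%N -> (l <= N)%N ->
    path_x (W k) y = path_x (W l) y -> height (take b (W k)) = y ->
  perm_eq (take b (W k)) (take b (W l)).
Proof.
move=> y0; elim: l => [|l IH]; first by rewrite leqn0 => /eqP->.
rewrite leq_eqVlt => /orP[/eqP->//|]; rewrite ltnS => kl lN eqx by_.
have x1 := path_x_mono y0 kl (ltnW lN); have x2 := path_x_mono y0 (leqnSn l) lN.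
have {}IH := IH kl (ltnW lN); have {}IH : perm_eq (take b (W k)) (take b (W l)).
  by apply: IH => //; lra.
have hE := height_perm IH; rewrite by_ in hE.
apply: perm_trans IH _; have eqx' : path_x (W l) y = path_x (W l.+1) y by lra.
have [u [i [j [v [Wl Wl' _ ij _]]]]] := sweep_step lN.
have out := sweep_outside lN y0 ij Wl Wl' eqx'.
rewrite Wl Wl'; apply: swap_take_perm; apply/eqP => bu; apply: out.
have [_ t1 _] := take_pair u v i j.
rewrite hE bu Wl t1 height_cat height_cons height_nil.
by have := xi_up xiP i; have := xi_up xiP j; lra.
Qed.

Lemma edge_persists k l (b : nat) y : 0 <= y -> (k <= l)%N -> (l <= N)%N ->
    path_x (W k) y = path_x (W l) y ->
    height (take b (W k)) < y < height (take b.+1 (W k)) ->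
  perm_eq (take b (W k)) (take b (W l)) /\ perm_eq (take b.+1 (W k)) (take b.+1 (W l)).
Proof.
move=> y0; elim: l => [|l IH]; first by rewrite leqn0 => /eqP->.
rewrite leq_eqVlt => /orP[/eqP->//|]; rewrite ltnS => kl lN eqx by_.
have x1 := path_x_mono y0 kl (ltnW lN); have x2 := path_x_mono y0 (leqnSn l) lN.
have [||IH1 IH2] := IH kl (ltnW lN) => //; first by lra.
have hE1 := height_perm IH1; have hE2 := height_perm IH2.
have eqx' : path_x (W l) y = path_x (W l.+1) y by lra.
have [u [i [j [v [Wl Wl' _ ij _]]]]] := sweep_step lN.
have out := sweep_outside lN y0 ij Wl Wl' eqx'.
have [t0 t1 t2] := take_pair u v i j.
have [yi yj] := (xi_up xiP i, xi_up xiP j).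
split; [apply: perm_trans IH1 _ | apply: perm_trans IH2 _];
  rewrite Wl Wl'; apply: swap_take_perm; apply/eqP => bu; apply: out.
  move: by_; rewrite hE1 hE2 bu Wl t1 t2 !height_cat !height_cons height_nil; lra.
case: bu => bu.
move: by_; rewrite hE1 hE2 bu Wl t1 t0 !height_cat !height_cons height_nil; lra.
Qed.

Lemma path_edges_swap u i j v e : e \notin tile_edges xi (psum xi u, i, j) ->
  (e \in path_edges xi 0 (u ++ i :: j :: v)) =
  (e \in path_edges xi 0 (u ++ j :: i :: v)).
Proof.
rewrite !path_edges_cat !mem_cat /= add0r !inE !negb_or.
have -> : psum xi u + xi j + xi i = psum xi u + xi i + xi j by rewrite addrAC.
by case/and4P=> /negbTE-> /negbTE-> /negbTE-> /negbTE->.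
Qed.

Definition swept e := exists2 t, t \in sweep_tiles & e \in tile_edges xi t.

Lemma mem_sweep_tiles k : (k < N)%N -> tile_at x0 (W k) (pos k) \in sweep_tiles.
Proof. by move=> kN; apply: map_f; rewrite mem_iota. Qed.

Lemma swept_step k e : (k < N)%N -> ~ swept e ->
  (e \in path_edges xi 0 (W k)) = (e \in path_edges xi 0 (W k.+1)).
Proof.
move=> kN ne; have tk := mem_sweep_tiles kN.
have [u [i [j [v [Wk Wk' _ _ tE]]]]] := sweep_step kN.
rewrite Wk Wk'; apply: path_edges_swap; apply/negP => et; apply: ne.
by exists (tile_at x0 (W k) (pos k)); rewrite // tE.
Qed.

(** An edge that belongs to no tile is never moved, so it would lie both on alpha and
on omega. The vectors before it would be on the left of xi m for alpha and on the right
for omega, with the same sum: there are none, and n = 1. *)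
Lemma swept_edge k e : (k <= N)%N -> e \in path_edges xi 0 (W k) -> swept e.
Proof.
move=> kN ek; apply: contrapT => ne.
have const m : (m <= N)%N -> (e \in path_edges xi 0 (W m)) = (e \in path_edges xi 0 (W 0)).
  by elim: m => // m IH mN; rewrite -swept_step // IH // ltnW.
have e0 : e \in path_edges xi 0 (W 0) by rewrite -(const k).
have eN : e \in path_edges xi 0 (W N) by rewrite const.
have [W0 WN _] := sw; rewrite W0 in e0; rewrite WN in eN.
case: e e0 eN {ek ne const} => q m.
move=> /path_edgesP[u [v /= [wE]]]; rewrite add0r => ->.
move=> /path_edgesP[u' [v' /= [wE']]]; rewrite add0r => uu'.
have uw : uniq (u ++ m :: v) by rewrite -wE enum_uniq.
have uw' : uniq (u' ++ m :: v') by rewrite -wE' word_uniq.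
have lt_u k' : k' \in u -> (k' < m)%N.
  by move=> ku; rewrite -before_enum wE; apply: before_cat; rewrite ?mem_head.
have gt_u k' : k' \in u' -> (m < k')%N.
  by move=> ku; rewrite -before_omega wE'; apply: before_cat; rewrite ?mem_head.
have cu : cross (xi m) (psum xi u) = \sum_(k' <- u) cross (xi m) (xi k').
  exact: cross_sum.
have cu' : cross (xi m) (psum xi u') = \sum_(k' <- u') cross (xi m) (xi k').
  exact: cross_sum.
have pos_u k' : k' \in u -> 0 < cross (xi m) (xi k').
  by move=> /lt_u h; rewrite crossC oppr_gt0; exact: cross_xi.
have neg_u k' : k' \in u' -> cross (xi m) (xi k') < 0.
  by move=> /gt_u h; exact: cross_xi.
have uN : u = [::].
  case: u {wE uw lt_u} uu' cu pos_u => // k' u uu' cu pos_u.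
  have : 0 < cross (xi m) (psum xi (k' :: u)).
    rewrite cu big_cons ltr_wpDr ?pos_u ?mem_head //.
    by rewrite big_seq sumr_ge0 // => l lu; rewrite ltW // pos_u // in_cons lu orbT.
  rewrite uu' cu' ltNge big_seq; case/negP.
  by rewrite -oppr_ge0 -sumrN sumr_ge0 // => l /neg_u; rewrite oppr_ge0; exact: ltW.
have u'N : u' = [::].
  case: u' {wE' uw' gt_u} uu' cu' neg_u => // k' u' uu' cu' neg_u.
  have : cross (xi m) (psum xi (k' :: u')) < 0.
    rewrite cu' big_cons -oppr_gt0 opprD ltr_wpDr ?oppr_gt0 ?neg_u ?mem_head //.
    by rewrite big_seq -sumrN sumr_ge0 // => l lu; rewrite oppr_ge0 ltW // neg_u // in_cons lu orbT.
  by rewrite -uu' uN psum_nil cross0r ltxx.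
have i0 : index m (enum 'I_n) = 0%N by rewrite wE uN /= eqxx.
have : index m (word (omega n)) = 0%N by rewrite wE' u'N /= eqxx.
rewrite index_word_omega; move: i0; rewrite index_enum_ord.
have := ltn_ord m; lia.
Qed.

(** The point at the height of p on alpha is on an edge of color m, and the linear form
cross (xi m) is maximal there; at equal heights, this compares
abscissas. The argument for omega is symmetric. *)
Lemma zonogon_path_x p : zonogon xi p ->
  0 <= ycoord p <= height (W 0) /\ path_x (W 0) (ycoord p) <= xcoord p <= path_x (W N) (ycoord p).
Proof.
move=> Zp; have [W0 WN _] := sw.
have y0N k : (k <= N)%N -> 0 <= ycoord p <= height (W k).
  move=> kN; case: Zp => a a01 ->; rewrite /height psum_all ?(sweep_perm sw) //.
  rewrite !ycoord_sum sumr_ge0 /=; last first.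
    move=> i _; rewrite coordE; apply: mulr_ge0; last by rewrite ltW // xi_up.
    by case/andP: (a01 i).
  apply: ler_sum => i _; rewrite coordE ler_piMl // ?(ltW (xi_up xiP i)) //.
  by case/andP: (a01 i).
have WkN k : (k <= N)%N -> W k != [::].
  move=> kN; rewrite -size_eq0 sweep_size //.
  by apply/eqP => n0; case: (x0) => l; rewrite n0.
split; first exact: y0N.
apply/andP; split.
  have [u [m [v [a [wE a01 yE]]]]] := path_point (WkN 0%N isT) (y0N 0%N isT).
  rewrite wE yE path_x_on //.
  have uw : uniq (u ++ m :: v) by rewrite -wE W0 enum_uniq.
  have bef (x y : 'I_n) : before (u ++ m :: v) x y -> (x < y)%N by rewrite -wE W0 before_enum.
  have pw : perm_eq (u ++ m :: v) (enum 'I_n) by rewrite -wE W0.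
  have [||||le _] := @zonogon_face _ _ xi (xi m) u m v p pw => //.
  - move=> k ku; rewrite crossC oppr_gt0; apply: cross_xi => //.
    by apply: bef; apply: before_cat; rewrite ?mem_head.
  - move=> k kv; apply: cross_xi => //; apply: bef.
    by rewrite -cat1s catA in uw *; apply: before_cat; rewrite // mem_cat mem_head orbT.
  - exact: crossvv.
  rewrite -subr_ge0 -(pmulr_rge0 _ (xi_up xiP m)).
  by move: le; rewrite /cross yE /height; lra.
have [u [m [v [a [wE a01 yE]]]]] := path_point (WkN N (leqnn N)) (y0N N (leqnn N)).
rewrite wE yE path_x_on //.
have uw : uniq (u ++ m :: v) by rewrite -wE WN word_uniq.
have bef (x y : 'I_n) : before (u ++ m :: v) x y -> (y < x)%N by rewrite -wE WN before_omega.
have pw : perm_eq (u ++ m :: v) (enum 'I_n) by rewrite -wE WN perm_word.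
have crossN q : cross (- xi m) q = - cross (xi m) q by rewrite /cross !coordE; ring.
have [||||le _] := @zonogon_face _ _ xi (- xi m) u m v p pw => //.
- move=> k ku; rewrite crossN oppr_gt0; apply: cross_xi => //.
  by apply: bef; apply: before_cat; rewrite ?mem_head.
- move=> k kv; rewrite crossN -crossC; apply: cross_xi => //; apply: bef.
  by rewrite -cat1s catA in uw *; apply: before_cat; rewrite // mem_cat mem_head orbT.
- by rewrite crossN crossvv oppr0.
rewrite -subr_ge0 -(pmulr_rge0 _ (xi_up xiP m)).
by move: le; rewrite !crossN /cross yE /height; lra.
Qed.

(** A point strictly on the right of alpha is crossed at some step, by a tile that
contains it. A point of alpha is on an edge of a tile by [swept_edge]. *)
Lemma sweep_covers :
  (\bigcup_(t in [set t | t \in sweep_tiles]) tile_set xi t)%classic = zonogon xi.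
Proof.
apply/seteqP; split=> p /=.
  move=> [t /mapP[k]]; rewrite mem_iota /= => kN ->.
  have [u [i [j [v [Wk _ _ _ ->]]]]] := sweep_step kN.
  move=> [a [b [a01 b01 ->]]]; apply: zonogon_psum_rhombus => //.
  have := sweep_perm sw (ltnW kN) => /perm_uniq; rewrite Wk enum_uniq cat_uniq /= !inE !negb_or.
  by case/and3P=> -> /and3P[-> -> _] /and3P[/andP[-> _] _ _].
move=> Zp; have [yp /andP[x0p xNp]] := zonogon_path_x Zp.
have [W0 WN _] := sw.
have [x_gt|x_le] := ltP (path_x (W 0) (ycoord p)) (xcoord p); last first.
  have xE : xcoord p = path_x (W 0) (ycoord p) by apply/eqP; rewrite eq_le x_le x0p.
  have W0N : W 0 != [::].
    by rewrite -size_eq0 sweep_size //; apply/eqP => n0; case: (x0) => l; rewrite n0.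
  have [u [m [v [a [wE a01 yE]]]]] := path_point W0N yp.
  have [|t tT et] := @swept_edge 0 (psum xi u, m) isT.
    by rewrite wE -[psum xi u]add0r; exact: mem_path_edges.
  exists t => //; apply: (edge_sub_tile et); exists a => //=.
  by apply: plane_ext; rewrite ?xE yE ?wE ?path_x_on // !coordE.
have [||k kN [Pk nPk]] := @chain_crossing (fun k => path_x (W k) (ycoord p) < xcoord p) N.
- exact: x_gt.
- by move=> h; lra.
have [u [i [j [v [Wk Wk' su ij tE]]]]] := sweep_step kN.
exists (tile_at x0 (W k) (pos k)); first exact: mem_sweep_tiles.
rewrite tE; apply: (@between_tile u v) => //; first by case/andP: yp.
by rewrite -Wk -Wk' Pk /=; rewrite leNgt; apply/negP.
Qed.

(** * The intersection of two swept tiles *)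

Section Intersection.
Variables k l : nat.
Hypotheses (kl : (k < l)%N) (lN : (l < N)%N).
Let w := W k.+1.
Let w' := W l.
Let t := tile_at x0 (W k) (pos k).
Let t' := tile_at x0 (W l) (pos l).

(** The vertex at position b of the right side of the earlier tile t, when it is also the
vertex at position b of the left side of the later tile t'. The vertices are
compared as sets of colors: this is stronger than equality of points. *)
Definition common_vertex (b : nat) :=
  [/\ perm_eq (take b w) (take b w'), (pos k <= b <= (pos k).+2)%N
    & (pos l <= b <= (pos l).+2)%N].

Let kN : (k < N)%N := ltn_trans kl lN.

(** The point p is on the right side of t and on the left side of t', hence on all paths
in between; the vertex or open edge of the path that contains it persists. *)
Lemma common_cell p : tile_set xi t p -> tile_set xi t' p ->
  (exists2 b, common_vertex b & p = psum xi (take b w)) \/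
  (exists b c, [/\ common_vertex b, common_vertex b.+1, 0 < c < 1
    & p = psum xi (take b w) + c *: xi (nth x0 w b)]).
Proof.
have [u [i [j [v [Wk Wk' su ij tE]]]]] := sweep_step kN.
have [u' [i' [j' [v' [Wl Wl' su' ij' tE']]]]] := sweep_step lN.
rewrite /t /t' tE tE' => /(tile_between v ij)[yk /andP[_ xk]].
move=> /(tile_between v' ij')[yl /andP[xl _]].
rewrite -Wk' -/w in xk; rewrite -Wl -/w' in xl.
set y := ycoord p in yk xk yl xl.
have y0 : 0 <= y by have := height_ge0 u; lra.
have mono := path_x_mono y0 kl (ltnW lN).
have xw : xcoord p = path_x w y by rewrite /w /w' in xk xl *; lra.
have xw' : path_x w y = path_x w' y by rewrite /w /w' in xk xl *; lra.
have sw_ : size w = n by exact: sweep_size.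
have sw'_ : size w' = n by apply: sweep_size; exact: ltnW.
have wN : w != [::] by rewrite /w Wk'; case: (u).
have yw : 0 <= y <= height w.
  rewrite y0 /=; apply: le_trans (_ : height u + Y i + Y j <= _); first by case/andP: yk.
  by rewrite /w Wk' height_cat !height_cons; have := height_ge0 v; lra.
have yk' : height u <= y <= height u + Y j + Y i by lra.
have [u0 [m [v0 [a [wE a01 yE]]]]] := path_point wN yw.
have pE : p = psum xi u0 + a *: xi m.
  by apply: plane_ext; rewrite ?xw -/y yE ?wE ?path_x_on // !coordE.
set b := size u0.
have bn : (b < n)%N by rewrite -sw_ wE size_cat /= addnS ltnS leq_addr.
have tb : take b w = u0 by rewrite wE take_size_cat.
have nb : nth x0 w b = m by rewrite wE nth_cat ltnn subnn.
have tb1 : take b.+1 w = rcons u0 m.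
  by rewrite (take_nth x0) ?sw_ // tb nb.
have hb1 : height (take b.+1 w) = height u0 + Y m.
  by rewrite tb1 -cats1 height_cat height_cons height_nil addr0.
have ym := xi_up xiP m.
have vertexP c : (c <= n)%N -> height (take c w) = y -> common_vertex c.
  move=> cn hc; have pc := vertex_persists y0 kl (ltnW lN) xw' hc.
  split=> //; rewrite -?su -?su'.
    by apply: (@height_window u j i v c y); rewrite // -Wk' -/w ?sw_.
  apply: (@height_window u' i' j' v' c y); rewrite // -Wl -/w' ?sw'_ //.
  by rewrite -(height_perm pc).
have [a0|a0] := eqVneq a 0.
  left; exists b; first by apply: vertexP; [exact: ltnW | rewrite tb yE a0 mul0r addr0].
  by rewrite pE tb a0 scale0r addr0.
have [a1|a1] := eqVneq a 1.
  left; exists b.+1; first by apply: vertexP; rewrite // hb1 yE a1 mul1r.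
  by rewrite pE tb1 -cats1 psum_cat psum_cons psum_nil addr0 a1 scale1r.
have {a0 a1}a01' : 0 < a < 1 by move: a01; rewrite !lt_neqAle [0 == a]eq_sym a0 a1.
have yb : height (take b w) < y < height (take b.+1 w) by rewrite hb1 tb yE; nra.
have [p1 p2] := edge_persists y0 kl (ltnW lN) xw' yb.
have win : (pos k <= b <= (pos k).+1)%N.
  rewrite -su; apply: (@height_window_edge u j i v b y) => //; rewrite -Wk' -/w ?sw_ //.
have win' : (pos l <= b <= (pos l).+1)%N.
  rewrite -su'; apply: (@height_window_edge u' i' j' v' b y) => //; rewrite -Wl -/w' ?sw'_ //.
  by rewrite -(height_perm p1) -(height_perm p2).
have cb : common_vertex b.
  by split=> //; [case/andP: win|case/andP: win'] => -> /leqW->.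
have cb1 : common_vertex b.+1.
  by split=> //; [case/andP: win|case/andP: win'] => /leqW-> h; rewrite ltnS h.
by right; exists b, a; split=> //; rewrite tb nb.
Qed.

Lemma common_vertex_mem b : common_vertex b ->
  psum xi (take b w) \in tile_vertices xi t /\ psum xi (take b w) \in tile_vertices xi t'.
Proof.
have [u [i [j [v [Wk Wk' su ij tE]]]]] := sweep_step kN.
have [u' [i' [j' [v' [Wl Wl' su' ij' tE']]]]] := sweep_step lN.
have [t0 t1 t2] := take_pair u v j i; have [t0' t1' t2'] := take_pair u' v' i' j'.
rewrite -Wk' -/w in t0 t1 t2; rewrite -Wl -/w' in t0' t1' t2'.
move=> [pb bk bl]; rewrite /t /t' tE tE'; split.
  have : b = size u \/ b = (size u).+1 \/ b = (size u).+2 by rewrite su; lia.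
  case=> [->|[->|->]]; rewrite ?t0 ?t1 ?t2 ?psum_cat ?psum_cons ?psum_nil ?addr0 /=;
    by rewrite !inE ?addrA 1?[_ + xi j + xi i]addrAC ?eqxx ?orbT.
rewrite (psum_perm xi pb).
have : b = size u' \/ b = (size u').+1 \/ b = (size u').+2 by rewrite su'; lia.
case=> [->|[->|->]]; rewrite ?t0' ?t1' ?t2' ?psum_cat ?psum_cons ?psum_nil ?addr0 /=;
  by rewrite !inE ?addrA ?eqxx ?orbT.
Qed.

Lemma common_vertex_next b : common_vertex b.+1 ->
  psum xi (take b.+1 w) = psum xi (take b w) + xi (nth x0 w b).
Proof.
move=> [_ bk _]; have [u [i [j [v [_ Wk' su _ _]]]]] := sweep_step kN.
have bw : (b < size w)%N by rewrite /w Wk' size_cat /= su; lia.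
by rewrite (take_nth x0 bw) -cats1 psum_cat psum_cons psum_nil addr0.
Qed.

Lemma common_edge_mem b : common_vertex b -> common_vertex b.+1 ->
  let e := (psum xi (take b w), nth x0 w b) in
  e \in tile_edges xi t /\ e \in tile_edges xi t'.
Proof.
have [u [i [j [v [Wk Wk' su ij tE]]]]] := sweep_step kN.
have [u' [i' [j' [v' [Wl Wl' su' ij' tE']]]]] := sweep_step lN.
have [t0 t1 t2] := take_pair u v j i; have [t0' t1' t2'] := take_pair u' v' i' j'.
move=> [pb bk bl] [pb1 bk1 bl1] e; rewrite /e /t /t' tE tE'.
have wn : (b < size w)%N.
  by rewrite /w Wk' size_cat /= su; lia.
have wn' : (b < size w')%N by rewrite /w' Wl size_cat /= su'; lia.
have eq_nth : nth x0 w b = nth x0 w' b.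
  by apply: (rcons_perm_last pb); rewrite -!(take_nth x0).
split.
  have : b = size u \/ b = (size u).+1 by rewrite su; lia.
  rewrite /w Wk'; case=> ->; rewrite ?t0 ?t1 nth_cat ?ltnn ?subnn /=;
    rewrite ?[(_.+1 < _)%N]ltnNge ?leqnSn ?subSnn /= ?psum_cat ?psum_cons ?psum_nil ?addr0;
    by rewrite !inE eqxx ?orbT.
rewrite eq_nth (psum_perm xi pb).
have : b = size u' \/ b = (size u').+1 by rewrite su'; lia.
rewrite /w' Wl; case=> ->; rewrite ?t0' ?t1' nth_cat ?ltnn ?subnn /=;
  rewrite ?[(_.+1 < _)%N]ltnNge ?leqnSn ?subSnn /= ?psum_cat ?psum_cons ?psum_nil ?addr0;
  by rewrite !inE eqxx ?orbT.
Qed.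

(** If two common vertices are not neighbours, they are the bottom and the top of both
tiles, which then have the same pair of colors. *)
Lemma common_vertex_gap b b' : common_vertex b -> common_vertex b' ->
  (b.+2 <= b')%N -> t = t'.
Proof.
have [u [i [j [v [Wk Wk' su ij tE]]]]] := sweep_step kN.
have [u' [i' [j' [v' [Wl Wl' su' ij' tE']]]]] := sweep_step lN.
have [t0 t1 t2] := take_pair u v j i; have [t0' t1' t2'] := take_pair u' v' i' j'.
move=> [pb bk bl] [pb' bk' bl'] gap; rewrite /t /t' tE tE'.
have [bu bu' b'u b'u'] : [/\ b = size u, b = size u', b' = (size u).+2 & b' = (size u').+2].
  by rewrite su su'; split; lia.
move: pb pb'; rewrite {1}bu bu' {1}b'u b'u' /w /w' Wk' Wl t0 t2 t0' t2' => pu pu2.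
have pij : perm_eq [:: j; i] [:: i'; j'].
  rewrite -(perm_cat2l u'); apply: perm_trans pu2.
  by rewrite perm_cat2r perm_sym.
rewrite (psum_perm xi pu); have /perm_mem pm := pij.
have := pm i; have := pm j; rewrite !inE !eqxx /= orbT.
move=> /esym/orP[/eqP ji'|/eqP jj'] /esym/orP[/eqP ii'|/eqP ij''].
- by move: ij; rewrite ii' ji' ltnn.
- by move: ij ij'; rewrite ij'' ji' => h1 h2; have := ltn_trans h1 h2; rewrite ltnn.
- by rewrite jj' ii'.
- by move: ij; rewrite jj' ij'' ltnn.
Qed.

(** By [common_vertex_gap] there are at most two common vertices, and two of them
bound a common edge. *)
Lemma sweep_tiles_meet : t != t' -> (tile_set xi t `&` tile_set xi t' !=set0)%classic ->
  (exists v : 'rV[R]_2, [/\ v \in tile_vertices xi t, v \in tile_vertices xi t'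
     & (tile_set xi t `&` tile_set xi t' = [set v])%classic]) \/
  (exists e : 'rV[R]_2 * 'I_n, [/\ e \in tile_edges xi t, e \in tile_edges xi t'
     & (tile_set xi t `&` tile_set xi t')%classic = edge_set xi e]).
Proof.
move=> /eqP neq [p0 [tp0 tp0']].
have near b b' : common_vertex b -> common_vertex b' -> (b' <= b.+1)%N.
  by move=> cb cb'; rewrite leqNgt; apply/negP => /(common_vertex_gap cb cb').
have [[b [cb cb1]]|noe] := pselect (exists b, common_vertex b /\ common_vertex b.+1).
  right; have [et et'] := common_edge_mem cb cb1.
  exists (psum xi (take b w), nth x0 w b); split=> //; apply/seteqP; split=> p.
    move=> [tp tp']; case: (common_cell tp tp') => [[c cc ->]|[c [a [cc cc1 a01 ->]]]] /=.
      have [->|->] : c = b \/ c = b.+1.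
        by have := near _ _ cb cc; have := near _ _ cc cb1; lia.
        by exists 0; rewrite ?lexx ?ler01 // scale0r addr0.
      exists 1; rewrite ?lexx ?ler01 // scale1r.
      exact: common_vertex_next.
    have -> : c = b.
      by have := near _ _ cb cc1; have := near _ _ cc cb1; lia.
    by exists a => //; lra.
  by move=> ep; split; [exact: (edge_sub_tile et) | exact: (edge_sub_tile et')].
left; case: (common_cell tp0 tp0') => [[b cb pE]|[b [a [cb cb1 _ _]]]]; last first.
  by case: noe; exists b.
have [vt vt'] := common_vertex_mem cb.
exists p0; rewrite pE; split=> //; apply/seteqP; split=> p /=; last by rewrite -pE => ->.
move=> [tp tp']; case: (common_cell tp tp') => [[c cc ->]|[c [a [cc cc1 _ _]]]]; last first.
  by case: noe; exists c.
suff -> : c = b by [].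
have h1 := near _ _ cb cc; have h2 := near _ _ cc cb.
have [//|[cE|bE]] : c = b \/ c = b.+1 \/ b = c.+1 by lia.
  by case: noe; exists b; rewrite -cE.
by case: noe; exists c; rewrite -bE.
Qed.

End Intersection.

Lemma sweep_tiling : rhombus_tiling xi sweep_tiles.
Proof.
split=> [t /mapP[k]|_|t t' /mapP[k + ->] /mapP[l + ->]].
- rewrite mem_iota /= => kN ->.
  by have [u [i [j [v [_ _ _ ij ->]]]]] := sweep_step kN.
- exact: sweep_covers.
rewrite !mem_iota /= => kN lN neq.
have [kl|lk|kl] := ltngtP k l; last by rewrite kl eqxx in neq.
  exact: sweep_tiles_meet.
rewrite setIC => meet; rewrite eq_sym in neq.
case: (sweep_tiles_meet lk kN neq meet) => [[z [z1 z2 E]]|[z [z1 z2 E]]].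
  by left; exists z.
by right; exists z.
Qed.

Lemma sweep_contains (D : {set 'S_n}) (s : 'S_n) : s \in D ->
    (forall k Z, (k <= N)%N -> Z \in prefixes D -> compatible (W k) Z) ->
  s \in Sigma xi sweep_tiles.
Proof.
move=> sD cW; rewrite inE snakeE //; apply/allP => -[q m] /path_edgesP[u [v /= [ws qE]]].
have uw := word_uniq s; rewrite ws in uw.
have /and3P[uu /norP[mu _] _] : [&& uniq u, ~~ has (mem u) (m :: v) & uniq (m :: v)].
  by rewrite -cat_uniq.
have uF : [set x in u] \in prefixes D by exact: (mem_prefixes sD ws).
have umF : m |: [set x in u] \in prefixes D.
  have -> : m |: [set x in u] = [set x in u ++ [:: m]].
    by apply/setP => x; rewrite !inE mem_cat inE orbC.
  by apply: (mem_prefixes sD (v := v)); rewrite ws -catA.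
have mF : m \notin [set x in u] by rewrite inE.
have [k [u' [v' [kN Wk uu']]]] := sweep_through_edge sw cW mF uF umF.
have pu : perm_eq u u'.
  apply: uniq_perm => // [|x]; last by rewrite uu' inE.
  have := sweep_perm sw kN => /perm_uniq; rewrite Wk enum_uniq cat_uniq.
  by case/andP.
apply/graph_edgesP => //; apply: (@swept_edge k) => //.
by rewrite qE (psum_perm xi pu) Wk; exact: mem_path_edges.
Qed.

End SweepTiling.

(** * Tiling, semi-connected and peak-pit domains *)

Lemma snake_one_color (R : realType) (xi : 'I_1 -> 'rV[R]_2) (T : seq (tile R 1))
  (s : 'S_1) : snake xi T (word s).
Proof.
have -> : word s = [:: ord0].
  by have := size_word s; case: (word s) => [//|x [|//]] _; rewrite [x]ord1.
rewrite /snake /= /graph_edges eqxx add0r big_ord1 eqxx andbT.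
by apply: map_f; rewrite mem_enum.
Qed.

Lemma Sigma_semi_connected (R : realType) (n : nat) (xi : 'I_n -> 'rV[R]_2)
    (T : seq (tile R n)) : (1 <= n)%N -> generators xi -> rhombus_tiling xi T ->
  semi_connected (Sigma xi T).
Proof.
move=> n_ge1 xiP tilT; have [n1|n_neq1] := eqVneq n 1%N.
  subst n; have all_in (s : 'S_1) : s \in Sigma xi T by rewrite inE snake_one_color.
  split; first by split.
  exists [::]; split=> //=; last by rewrite all_in.
  by apply/permP => k; rewrite !ord1.
have aT : snake xi T (word (alpha n)) by exact: snake_alpha.
have [p [pp pl pD]] := snake_to_omega xiP n_neq1 tilT aT.
split; last by exists p.
split; first by rewrite inE.
by rewrite -pl; move/allP: pD => /(_ _ (mem_last _ _)).
Qed.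

Lemma peak_pit_in_tiling (R : realType) (n : nat) (xi : 'I_n -> 'rV[R]_2)
    (D : {set 'S_n}) : (1 <= n)%N -> generators xi -> peak_pit_domain D ->
  exists T : seq (tile R n), rhombus_tiling xi T /\ D \subset Sigma xi T.
Proof.
move=> n_ge1 xiP ppD; have [n1|n_neq1] := eqVneq n 1%N.
  subst n; exists [::]; split; last first.
    by apply/fintype.subsetP => s _; rewrite inE snake_one_color.
  by split.
have sepD := peak_pit_separated ppD.
have above_enum Y : above (enum 'I_n) Y by move=> x y; rewrite before_enum.
have [|N [W [pos [W0 WN st cW]]]] := compatible_chain sepD (perm_refl (enum 'I_n)).
  by move=> Y _; left.
have sw : sweep N W pos by [].
pose x0 := Ordinal n_ge1.
exists (sweep_tiles xi x0 N W pos); split; first exact: sweep_tiling.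
by apply/fintype.subsetP => s sD; apply: (sweep_contains xiP x0 sw n_neq1 sD) => k Z; exact: cW.
Qed.

Theorem theorem4 (R : realType) (n : nat) (xi : 'I_n -> 'rV[R]_2)
    (n_ge1 : (1 <= n)%N) (xiP : generators xi) :
  [/\ forall D : {set 'S_n}, tiling_type xi D -> semi_connected D,
      forall D : {set 'S_n},
        condorcet_domain D -> semi_connected D -> peak_pit_domain D
    & forall D : {set 'S_n}, peak_pit_domain D ->
        exists D' : {set 'S_n}, tiling_type xi D' /\ D \subset D'].
Proof.
split=> [D [T [tilT ->]]|D|D ppD].
- exact: Sigma_semi_connected.
- exact: condorcet_semi_connected_peak_pit.
have [T [tilT DT]] := peak_pit_in_tiling n_ge1 xiP ppD.
by exists (Sigma xi T); split=> //; exists T.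
Qed.
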